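(* Let $n\ge 3$ and let $M^n$ be an $n$-dimensional Riemannian submanifold of an $(n+p)$-dimensional Riemannian manifold $(\widetilde N^{n+p},\widetilde g)$ carrying the Agashe–Chafle semi-symmetric non-metric connection $\widetilde\nabla_XY=\mathring{\widetilde\nabla}_XY+\phi(Y)X$ associated with a $1$-form $\phi$. Then for every $x\in M^n$ and every unit vector $X\in T_xM^n$, $$\operatorname{Ric}(X)\ \ge\ \Theta(X)-\lambda+s(X,X)-n\,\phi(H)+\widetilde g\bigl(P^\perp,\sigma(X,X)\bigr)+\mathcal H(H,\sigma),$$ where $$\mathcal H(H,\sigma)=\frac{n-1}{n}\left(2n\|H\|^2-\|\sigma\|^2-(n-2)\|H\|\sqrt{\frac{n\left(\|\sigma\|^2-n\|H\|^2\right)}{n-1}}\right).$$ Equality holds at $x$ (for the vector $X$) if and only if both of the following hold: (i) in an orthonormal frame $\{e_1=X,e_2,\dots,e_n\}$ of $T_xM^n$, for each $\alpha\in\{n+1,\dots,n+p\}$ the matrix $A_\alpha=(\sigma^\alpha_{ij})_{1\le i,j\le n}$ has the form $A_\alpha=\operatorname{diag}(\lambda_\alpha,\mu_\alpha,\dots,\mu_\alpha)$ with $$\lambda_\alpha=H^\alpha-\frac{n-1}{n}\,\varepsilon_\alpha\sqrt{\frac{n\|\sigma^\alpha\|^2-n^2(H^\alpha)^2}{n-1}},\qquad \mu_\alpha=H^\alpha+\frac1n\,\varepsilon_\alpha\sqrt{\frac{n\|\sigma^\alpha\|^2-n^2(H^\alpha)^2}{n-1}},$$ where $\varepsilon_\alpha=\operatorname{sgn}(H^\alpha)$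 if $H^\alpha\ne0$, and $\varepsilon_\alpha\in\{+1,-1\}$ (either choice) if $H^\alpha=0$; (ii) writing $D_\alpha:=|\lambda_\alpha-\mu_\alpha|=\sqrt{\frac{n(\|\sigma^\alpha\|^2-n(H^\alpha)^2)}{n-1}}$, if $H\neq0$ at $x$ then there exists $\rho\ge0$ such that $D_\alpha=\rho\,|H^\alpha|$ for all $\alpha$ (so that, when $H\ne 0$, any $\alpha$ with $H^\alpha=0$ satisfies $D_\alpha=0$, i.e. $(\sigma^\alpha_{ij})$ is a scalar matrix).
   Context: Setting and notation. $\mathring{\widetilde\nabla}$ is the Levi-Civita connection of $\widetilde g$ and $\mathring{\widetilde R}$ its curvature tensor, with the convention $R(X,Y)Z=\nabla_X\nabla_YZ-\nabla_Y\nabla_XZ-\nabla_{[X,Y]}Z$ and $R(X,Y,Z,W)=g(R(X,Y)Z,W)$ (so constant sectional curvature $c$ means $R(X,Y,Z,W)=c\{g(X,W)g(Y,Z)-g(X,Z)g(Y,W)\}$). For a $1$-form $\phi$ on $\widetilde N$, the Agashe–Chafle semi-symmetric non-metric connection is $\widetilde\nabla_XY=\mathring{\widetilde\nabla}_XY+\phi(Y)X$. The vector field $P$ is defined by $\widetilde g(P,X)=\phi(X)$; along $M^n$ write $P=P^\top+P^\perp$ (tangential and normal parts). The $(0,2)$-tensor $s$ on $\widetilde N$ is $s(X,Y)=(\mathring{\widetilde\nabla}_X\phi)(Y)-\phi(X)\phi(Y)$. $M^n$ carries the induced metric $g$. The induced connection $\nabla$ and second fundamental form $\sigma$ are defined by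 $\widetilde\nabla_XY=\nabla_XY+\sigma(X,Y)$ (tangential plus normal part) for $X,Y$ tangent to $M$; $\sigma$ coincides with the usual Levi-Civita second fundamental form. $R$ denotes the curvature tensor of the induced connection $\nabla$ on $M$. Given orthonormal frames $\{e_1,\dots,e_n\}$ of $T_xM$ and $\{e_{n+1},\dots,e_{n+p}\}$ of the normal space $T^\perp_xM$: $\sigma^\alpha_{ij}=\widetilde g(\sigma(e_i,e_j),e_\alpha)$, $\|\sigma^\alpha\|^2=\sum_{i,j}(\sigma^\alpha_{ij})^2$, $\|\sigma\|^2=\sum_\alpha\|\sigma^\alpha\|^2$, $H=\frac1n\sum_i\sigma(e_i,e_i)$, $H^\alpha=\frac1n\sum_i\sigma^\alpha_{ii}$, $\lambda=\sum_{i=1}^n s(e_i,e_i)$ (trace of $s$ over $T_xM$; not to be confused with the eigenvalues $\lambda_\alpha$), and $\phi(H)=\widetilde g(P^\perp,H)$. Convention for the Ricci curvature (needed since $R$ lacks the usual symmetries): for a unit $X=e_1$ completed to an orthonormal basis of $T_xM$, $\operatorname{Ric}(X):=\sum_{j=2}^nR(X,e_j,e_j,X)$. Also $\Theta(X):=\sum_{j=2}^n\mathring{\widetilde R}(X,e_j,e_j,X)$. *)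

(* Defs.v *)
From HB Require Import structures.
From mathcomp Require Import all_boot all_order all_algebra.
From mathcomp Require Import all_classical all_reals all_analysis.
From mathcomp Require Import ring.

Set Implicit Arguments.
Unset Strict Implicit.
Unset Printing Implicit Defensive.
Import Order.TTheory GRing.Theory Num.Theory.
Import numFieldNormedType.Exports.

Local Open Scope classical_set_scope.
Local Open Scope ring_scope.

Fixpoint is_Ck (R : realType) (V W : normedModType R) (k : nat) (U : set V)
    (f : V -> W) : Prop :=
  match k with
  | 0 => forall u, U u -> {for u, continuous f}
  | k'.+1 => (forall u, U u -> differentiable f u) /\
             (forall v : V, is_Ck k' U ('D_v f))
  end.

(* C^oo on U; only used for open U. *)
Definition smooth_on (R : realType) (V W : normedModType R) (U : set V)
    (f : V -> W) : Prop := forall k, is_Ck k U f.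

(* A homeomorphism from an open subset of T onto an open subset of R^m; the two
   maps are total functions, their values outside these sets are irrelevant. *)
Record chart (R : realType) (T : topologicalType) (m : nat) := Chart {
  chart_dom : set T;
  chart_cod : set 'rV[R]_m;
  chart_map : T -> 'rV[R]_m;
  chart_inv : 'rV[R]_m -> T;
  chart_dom_open : open chart_dom;
  chart_cod_open : open chart_cod;
  chart_map_cod : forall x, chart_dom x -> chart_cod (chart_map x);
  chart_inv_dom : forall u, chart_cod u -> chart_dom (chart_inv u);
  chart_mapK : forall x, chart_dom x -> chart_inv (chart_map x) = x;
  chart_invK : forall u, chart_cod u -> chart_map (chart_inv u) = u;
  chart_map_continuous : forall x, chart_dom x -> {for x, continuous chart_map};
  chart_inv_continuous : forall u, chart_cod u -> {for u, continuous chart_inv}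
}.

(* The map f read in the charts c and d, and the open set where this makes
   sense. Transition maps are the case f = id. *)
Definition local_rep (R : realType) (T1 T2 : topologicalType) (m1 m2 : nat)
    (f : T1 -> T2) (c : chart R T1 m1) (d : chart R T2 m2) :
    'rV[R]_m1 -> 'rV[R]_m2 :=
  fun u => chart_map d (f (chart_inv c u)).

Definition local_dom (R : realType) (T1 T2 : topologicalType) (m1 m2 : nat)
    (f : T1 -> T2) (c : chart R T1 m1) (d : chart R T2 m2) : set 'rV[R]_m1 :=
  [set u | chart_cod c u /\ chart_dom d (f (chart_inv c u))].

Record manifold (R : realType) (m : nat) := Manifold {
  mcarrier :> topologicalType;
  atlas : set (chart R mcarrier m);
  manifold_hausdorff : hausdorff_space mcarrier;
  manifold_second_countable : @second_countable mcarrier;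
  atlas_cover : forall x, exists2 c, atlas c & chart_dom c x;
  atlas_smooth : forall c d, atlas c -> atlas d ->
    smooth_on (local_dom idfun c d) (local_rep idfun c d)
}.

(* Bilinear form of matrix G, and pairing of a covector a with a vector x;
   vectors and covectors are both row vectors of components. *)
Definition ip (R : realType) (m : nat) (G : 'M[R]_m) (x y : 'rV[R]_m) : R :=
  (x *m G *m y^T) 0 0.

Definition pairing (R : realType) (m : nat) (a x : 'rV[R]_m) : R :=
  (a *m x^T) 0 0.

(* A Riemannian metric: its matrix of components in every chart of the atlas,
   subject to the transformation law of (0,2)-tensors. The library's Jacobian
   acts on row vectors: 'd f u x = x *m 'J f u. *)
Record riem_metric (R : realType) (m : nat) (N : manifold R m) := RiemMetric {
  metric_in : chart R N m -> 'rV[R]_m -> 'M[R]_m;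
  metric_smooth : forall c, atlas c -> smooth_on (chart_cod c) (metric_in c);
  metric_sym : forall c u, atlas c -> chart_cod c u ->
    (metric_in c u)^T = metric_in c u;
  metric_pos : forall c u x, atlas c -> chart_cod c u -> x != 0 ->
    0 < ip (metric_in c u) x x;
  metric_change : forall c d u, atlas c -> atlas d -> local_dom idfun c d u ->
    metric_in c u = 'J (local_rep idfun c d) u
                    *m metric_in d (local_rep idfun c d u)
                    *m ('J (local_rep idfun c d) u)^T
}.

Record one_form (R : realType) (m : nat) (N : manifold R m) := OneForm {
  form_in : chart R N m -> 'rV[R]_m -> 'rV[R]_m;
  form_smooth : forall c, atlas c -> smooth_on (chart_cod c) (form_in c);
  form_change : forall c d u, atlas c -> atlas d -> local_dom idfun c d u ->
    form_in c u = form_in d (local_rep idfun c d u)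
                  *m ('J (local_rep idfun c d) u)^T
}.

Record immersion (R : realType) (n m : nat) (M : manifold R n)
    (N : manifold R m) := Immersion {
  imm_map :> M -> N;
  imm_continuous : continuous imm_map;
  imm_smooth : forall c d, atlas c -> atlas d ->
    smooth_on (local_dom imm_map c d) (local_rep imm_map c d);
  imm_inj : forall c d u, atlas c -> atlas d -> local_dom imm_map c d u ->
    injective ('d (local_rep imm_map c d) u)
}.

(* In a chart, a vector field is a map from coordinates to components, and a
   connection is an operator on such fields. Below, the value of a tensor on
   tangent vectors at u is obtained by extending them to fields with constant
   components; by tensoriality any extension gives the same value. *)

Section Connections.
Context {R : realType} {m : nat}.
Local Notation vec := 'rV[R]_m.
Implicit Types (X Y Z : vec -> vec) (Gam : vec -> vec -> vec -> vec).

(* Gam u x y = Gamma^k_ij(u) x^i y^j. *)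
Definition cov Gam X Y : vec -> vec :=
  fun u => 'D_(X u) Y u + Gam u (X u) (Y u).

Definition lie X Y : vec -> vec := fun u => 'D_(X u) Y u - 'D_(Y u) X u.

Definition curv (nabla : (vec -> vec) -> (vec -> vec) -> vec -> vec) X Y Z :
    vec -> vec :=
  fun u => nabla X (nabla Y Z) u - nabla Y (nabla X Z) u
           - nabla (lie X Y) Z u.

Definition curv4 (nabla : (vec -> vec) -> (vec -> vec) -> vec -> vec)
    (g : vec -> 'M[R]_m) (u x y z w : vec) : R :=
  ip (g u) (curv nabla (cst x) (cst y) (cst z) u) w.

(* Christoffel symbols of the Levi-Civita connection of g:
   2 g(Gam(x, y), z) = (D_x g)(y, z) + (D_y g)(x, z) - (D_z g)(x, y). *)
Definition levi_civita (g : vec -> 'M[R]_m) : vec -> vec -> vec -> vec :=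
  fun u x y => 2^-1 *: (\row_l (ip ('D_x g u) y (delta_mx 0 l)
                                + ip ('D_y g u) x (delta_mx 0 l)
                                - ip ('D_(delta_mx 0 l) g u) x y))
               *m invmx (g u).

Definition agashe_chafle (g : vec -> 'M[R]_m) (phi : vec -> vec) :
    vec -> vec -> vec -> vec :=
  fun u x y => levi_civita g u x y + pairing (phi u) y *: x.

Definition cov_form Gam (phi : vec -> vec) X Y : vec -> R :=
  fun u => 'D_(X u) (fun v => pairing (phi v) (Y v)) u
           - pairing (phi u) (cov Gam X Y u).

Definition s_tensor (g : vec -> 'M[R]_m) (phi : vec -> vec) (u x y : vec) : R :=
  cov_form (levi_civita g) phi (cst x) (cst y) u
  - pairing (phi u) x * pairing (phi u) y.

(* The vector field P with g(P, .) = phi. *)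
Definition dual_field (g : vec -> 'M[R]_m) (phi : vec -> vec) : vec -> vec :=
  fun u => phi u *m invmx (g u).

End Connections.

(* F stands for an immersion read in charts of the two manifolds. *)

Section Submanifold.
Context {R : realType} {n m : nat}.
Variables (g : 'rV[R]_m -> 'M[R]_m) (phi : 'rV[R]_m -> 'rV[R]_m).
Variable F : 'rV[R]_n -> 'rV[R]_m.
Implicit Types (X Y : 'rV[R]_n -> 'rV[R]_n) (V : 'rV[R]_n -> 'rV[R]_m).

Definition induced_metric (u : 'rV[R]_n) : 'M[R]_n :=
  'J F u *m g (F u) *m ('J F u)^T.

(* The vector z of T_uM such that 'd F u z is the orthogonal projection of v
   to the tangent space; see normal_part_orth below. *)
Definition tan_coord (u : 'rV[R]_n) (v : 'rV[R]_m) : 'rV[R]_n :=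
  v *m g (F u) *m ('J F u)^T *m invmx (induced_metric u).

Definition normal_part (u : 'rV[R]_n) (v : 'rV[R]_m) : 'rV[R]_m :=
  v - 'd F u (tan_coord u v).

(* The pullback by F of the Agashe-Chafle connection: V is a field along F. *)
Definition cov_along X V : 'rV[R]_n -> 'rV[R]_m :=
  fun u => 'D_(X u) V u + agashe_chafle g phi (F u) ('d F u (X u)) (V u).

Definition push Y : 'rV[R]_n -> 'rV[R]_m := fun u => 'd F u (Y u).

Definition induced_conn X Y : 'rV[R]_n -> 'rV[R]_n :=
  fun u => tan_coord u (cov_along X (push Y) u).

Definition sff (u x y : 'rV[R]_n) : 'rV[R]_m :=
  normal_part u (cov_along (cst x) (push (cst y)) u).

Definition tangent_frame (u : 'rV[R]_n) (e : 'I_n -> 'rV[R]_n) : Prop :=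
  forall i j, ip (induced_metric u) (e i) (e j) = (i == j)%:R.

Definition normal_frame (p : nat) (u : 'rV[R]_n) (nu : 'I_p -> 'rV[R]_m) :
    Prop :=
  (forall a b, ip (g (F u)) (nu a) (nu b) = (a == b)%:R) /\
  (forall a x, ip (g (F u)) (nu a) ('d F u x) = 0).

Section AtPoint.
Variables (u : 'rV[R]_n) (e : 'I_n -> 'rV[R]_n).

(* The frame is indexed from 0: the sums over (0 < j) leave out its first
   vector, which is meant to be X. *)
Definition ricci (X : 'rV[R]_n) : R :=
  \sum_(j < n | (0 < j)%N)
     curv4 induced_conn induced_metric u X (e j) (e j) X.

Definition theta (X : 'rV[R]_n) : R :=
  \sum_(j < n | (0 < j)%N)
     curv4 (cov (levi_civita g)) g (F u)
       ('d F u X) ('d F u (e j)) ('d F u (e j)) ('d F u X).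

Definition trace_s : R :=
  \sum_(i < n) s_tensor g phi (F u) ('d F u (e i)) ('d F u (e i)).

Definition mean_curv : 'rV[R]_m := n%:R^-1 *: \sum_(i < n) sff u (e i) (e i).

Definition mean_curv_norm : R := Num.sqrt (ip (g (F u)) mean_curv mean_curv).

Definition sff_mx (v : 'rV[R]_m) : 'M[R]_n :=
  \matrix_(i, j) ip (g (F u)) (sff u (e i) (e j)) v.

Definition sff_norm2 (v : 'rV[R]_m) : R := \sum_i \sum_j (sff_mx v i j) ^+ 2.

Definition mean_comp (v : 'rV[R]_m) : R := n%:R^-1 * \sum_i sff_mx v i i.

Definition eig_gap (v : 'rV[R]_m) : R :=
  Num.sqrt ((n%:R * sff_norm2 v - n%:R ^+ 2 * mean_comp v ^+ 2)
            / (n%:R - 1)).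

Definition eig_lambda (eps : R) (v : 'rV[R]_m) : R :=
  mean_comp v - (n%:R - 1) / n%:R * eps * eig_gap v.

Definition eig_mu (eps : R) (v : 'rV[R]_m) : R :=
  mean_comp v + n%:R^-1 * eps * eig_gap v.

End AtPoint.

Lemma normal_part_orth (u x : 'rV[R]_n) (v : 'rV[R]_m) :
  induced_metric u \in unitmx ->
  ip (g (F u)) (normal_part u v) ('d F u x) = 0.
Proof.
move=> Gu.
have dE y : 'd F u y = y *m 'J F u by rewrite mul_rV_lin1.
have nE : normal_part u v *m g (F u) *m ('J F u)^T = 0.
  rewrite /normal_part dE !mulmxBl -[X in _ - X]mulmxA -[X in _ - X]mulmxA.
  by rewrite (mulmxA ('J F u)) -/(induced_metric u) /tan_coord mulmxKV // subrr.
by rewrite /ip dE trmx_mul mulmxA nE mul0mx mxE.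
Qed.

End Submanifold.

(* h = ||H||, S = ||sigma||^2 *)
Definition scrH (R : realType) (n : nat) (h S : R) : R :=
  (n%:R - 1) / n%:R *
  (2 * n%:R * h ^+ 2 - S
   - (n%:R - 2) * h
     * Num.sqrt (n%:R * (S - n%:R * h ^+ 2) / (n%:R - 1))).

Lemma ip_sym (R : realType) (m : nat) (G : 'M[R]_m) (x y : 'rV[R]_m) :
  G^T = G -> ip G x y = ip G y x.
Proof.
move=> GT; transitivity ((x *m G *m y^T)^T 0 0); first by rewrite /ip [RHS]mxE.
by rewrite !trmx_mul trmxK GT mulmxA.
Qed.

Lemma ip_linear (R : realType) (m : nat) (G : 'M[R]_m) (x z : 'rV[R]_m) :
  ip G x z = \sum_l z 0 l * ip G x (delta_mx 0 l).
Proof.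
rewrite {1}(row_sum_delta z) /ip linear_sum /= mulmx_sumr summxE.
by apply: eq_bigr => l _; rewrite linearZ /= -scalemxAr mxE.
Qed.

(* The Levi-Civita connection is the unique torsion-free connection compatible
   with g; these lemmas check the coordinate formula levi_civita against that. *)
Section LeviCivita.
Context {R : realType} {m : nat}.
Implicit Types (g : 'rV[R]_m -> 'M[R]_m) (u x y z : 'rV[R]_m).

Lemma levi_civita_koszul g u x y z :
  differentiable g u -> g u \in unitmx ->
  ip (g u) (levi_civita g u x y) z =
  2^-1 * (ip ('D_x g u) y z + ip ('D_y g u) x z - ip ('D_z g u) x y).
Proof.
move=> dg gu.
have dgz : ip ('D_z g u) x y =
    \sum_l z 0 l * ip ('D_(delta_mx 0 l) g u) x y.
  rewrite !deriveE // {1}(row_sum_delta z) linear_sum /ip.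
  rewrite mulmx_sumr mulmx_suml summxE; apply: eq_bigr => l _.
  by rewrite linearZ /= -scalemxAr -scalemxAl mxE deriveE.
rewrite {1}/ip /levi_civita -!scalemxAl mulmxKV // mxE; congr (_ * _).
rewrite dgz (ip_linear _ y) (ip_linear _ x) -big_split -sumrB mxE /=.
by apply: eq_bigr => l _; rewrite !mxE mulrC mulrBr mulrDr.
Qed.

Lemma levi_civita_torsion_free g u x y :
  (forall v, ('D_v g u)^T = 'D_v g u) ->
  levi_civita g u x y = levi_civita g u y x.
Proof.
move=> dgT; rewrite /levi_civita; congr (_ *: _ *m _); apply/rowP => l.
by rewrite !mxE [X in X - _]addrC (ip_sym x y (dgT _)).
Qed.

Lemma levi_civita_metric g u x y z :
  differentiable g u -> g u \in unitmx -> (g u)^T = g u ->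
  (forall v, ('D_v g u)^T = 'D_v g u) ->
  ip ('D_z g u) x y =
  ip (g u) (levi_civita g u z x) y + ip (g u) x (levi_civita g u z y).
Proof.
move=> dg gu gT dgT; rewrite [X in _ = _ + X]ip_sym // !levi_civita_koszul //.
rewrite (ip_sym y x (dgT z)) (ip_sym z y (dgT x)) (ip_sym z x (dgT y)).
by field.
Qed.

End LeviCivita.

(* Main.v *)
Require Import Defs.
From HB Require Import structures.
From mathcomp Require Import all_boot all_order all_algebra.
From mathcomp Require Import ring lra.
From mathcomp Require Import all_classical all_reals all_analysis.
Import Order.TTheory GRing.Theory Num.Theory.
Import numFieldNormedType.Exports.
Local Open Scope classical_set_scope.
Local Open Scope ring_scope.

Set Implicit Arguments.
Unset Strict Implicit.
Unset Printing Implicit Defensive.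

(** The proof has a differential-geometric half and an algebraic half.

    Geometry. The Agashe-Chafle connection differs from the Levi-Civita
    connection by [phi(Y) X]. In the ambient manifold this changes the curvature
    only by terms in [s] ([agashe_chafle_curv]). The induced connection is the
    tangential part of the pulled back one, whose curvature is the pulled back
    curvature ([pullback_curvature], which rests on the symmetry of mixed second
    derivatives); what is lost by projecting is computed by differentiating
    [g(sigma, dF w) = 0] ([weingarten]). This gives the Gauss equation
    [gauss_equation]. Summed over [R(X, e_j, e_j, X)] it yields [ricci_frame]:
    [Ric(X)] equals all the terms of the bound other than [scrH], plus
    [sum_j (g(sigma(X, X), sigma(e_j, e_j)) - |sigma(X, e_j)|^2)].

    Algebra. By Parseval in the normal space this last sum splits into one
    contribution [A_00 tr A - sum_j A_0j^2] for each normal direction, [A]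
    being its shape matrix. Write [a = A_00], [mu] for the average of the
    other diagonal entries, [h] for the mean of all, [D] for the eigenvalue
    gap [mx_gap], [q] for the squared norm of the off-diagonal part of the
    first row, and [r] for the squared distance from the lower block to [mu]
    times the identity. The contribution exceeds the bound for that
    direction by [(n-2) (n-1)/n (h (a - mu) + |h| D) + (n-2)/n q + (n-1)/n
    r], and since [|a - mu| <= D] every term is nonnegative. For [n >= 3]
    they all vanish exactly for the matrices [diag(lambda, mu, .., mu)] of
    the statement ([ricci_excess_eq0]). Finally the bounds for the separate
    directions are added with the Cauchy-Schwarz inequality [sum_a |H^a| D_a
    <= |H| sqrt(sum_a D_a^2)], whose equality case is the proportionality of
    the gaps to the [|H^a|] ([scrH_eq_sum]).

    The frame in the equality condition may differ from the one in the Ricci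
    sum, but mean, norm and excess of a shape matrix do not depend on the
    vectors completing [X] to a frame ([ricci_excess_frame]). *)

(** * Differentiation of matrix-valued maps *)

Section MatrixCalculus.
Context {R : realType} {V : normedModType R}.

Lemma near_eq_differentiable (W : normedModType R) (f h : V -> W) (u : V) :
  (\near u, f u = h u) -> differentiable f u -> differentiable h u.
Proof.
move=> fh df.
pose k := h - f.
have k0 : \forall w \near u, k w = 0.
  by near=> w; rewrite /k !fctE; have -> : f w = h w; [near: w|rewrite subrr].
have ku : k u = 0 by exact: (nbhs_singleton k0).
have k0' : \forall w \near 0, k (w + u) = 0.
  by move: k0; rewrite (near_shift 0) /= subr0.
have ko : k \o shift u = cst (k u) + (\0 : V -> W) +o_ 0 id.
  apply/eqaddoP => _/posnumP[eps]; move: k0'; apply: filterS => w kw.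
  by rewrite !fctE /= ku kw addr0 subr0 normr0 mulr_ge0.
have dk0 : 'd k u = \0 :> (V -> W).
  by apply: diff_unique => // w; exact: cvg_cst.
have dk : differentiable k u.
  by apply/diff_locallyP; rewrite dk0; split => // w; exact: cvg_cst.
have -> : h = f + k by apply/funext => w; rewrite /k !fctE addrC subrK.
exact: differentiableD.
Unshelve. all: by end_near. Qed.

Lemma differentiable_mxP m n (A : V -> 'M[R]_(m, n)) (u : V) :
  differentiable A u <-> forall i j, differentiable (fun w => A w i j) u.
Proof.
split=> [dA i j|dA].
  exact: (differentiable_comp dA (differentiable_coord _ _ _)).
have -> : A = \sum_i \sum_j (fun w => A w i j *: delta_mx i j).
  apply/funext => w; rewrite {1}[A w]matrix_sum_delta fct_sumE.
  by apply: eq_bigr => i _; rewrite fct_sumE.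
by apply: differentiable_sum => i; apply: differentiable_sum => j;
  exact: differentiableZl.
Qed.

Lemma differentiable_prod n (f : 'I_n -> V -> R) (u : V) :
  (forall i, differentiable (f i) u) ->
  differentiable (fun w => \prod_(i < n) f i w) u.
Proof.
move=> df; elim: n f df => [|n IH] f df.
  by under eq_fun do rewrite big_ord0; exact: differentiable_cst.
under eq_fun do rewrite big_ord_recl.
by apply: differentiableM; [exact: df|apply: IH => i; exact: df].
Qed.

Lemma differentiable_bigsum (I : finType) (W : normedModType R)
    (f : I -> V -> W) (u : V) :
  (forall i, differentiable (f i) u) ->
  differentiable (fun w => \sum_i f i w) u.
Proof.
move=> df; rewrite (_ : (fun w => _) = \sum_i f i); last first.
  by apply/funext => w; rewrite fct_sumE.
elim/big_ind : _ => // ? ? ? ?; exact: differentiableD.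
Qed.

Lemma differentiable_mulmx m n p (A : V -> 'M[R]_(m, n)) (B : V -> 'M[R]_(n, p))
    (u : V) :
  differentiable A u -> differentiable B u ->
  differentiable (fun w => A w *m B w) u.
Proof.
move=> /differentiable_mxP dA /differentiable_mxP dB.
apply/differentiable_mxP => i j; under eq_fun do rewrite mxE.
by apply: differentiable_bigsum => k; exact: differentiableM.
Qed.

Lemma differentiable_trmx m n (A : V -> 'M[R]_(m, n)) (u : V) :
  differentiable A u -> differentiable (fun w => (A w)^T) u.
Proof.
move=> /differentiable_mxP dA; apply/differentiable_mxP => i j.
by under eq_fun do rewrite mxE; exact: dA.
Qed.

Lemma differentiable_det n (A : V -> 'M[R]_n) (u : V) :
  differentiable A u -> differentiable (fun w => \det (A w)) u.
Proof.
move=> /differentiable_mxP dA; apply: differentiable_bigsum => s.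
by apply: differentiableZ; apply: differentiable_prod => i; exact: dA.
Qed.

(** Cramer's rule writes the inverse as a rational function of the entries. *)
Lemma differentiable_invmx n (A : V -> 'M[R]_n) (u : V) :
  differentiable A u -> A u \in unitmx ->
  differentiable (fun w => invmx (A w)) u.
Proof.
move=> dA Au; have ddet := differentiable_det dA.
have det0 : \det (A u) != 0 by rewrite -unitfE -unitmxE.
apply: (@near_eq_differentiable _ (fun w => (\det (A w))^-1 *: \adj (A w))).
  have cdet : {for u, continuous (fun w => \det (A w))}.
    exact: differentiable_continuous.
  have detN0 : \forall w \near u, \det (A w) != 0 by exact: cvgr_neq0 cdet det0.
  by move: detN0; apply: filterS => w detw; rewrite /invmx unitmxE unitfE detw.
apply/differentiable_mxP => i j; under eq_fun do rewrite !mxE.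
apply: differentiableM.
  exact: (@differentiableV _ _ (fun w => \det (A w))).
rewrite /cofactor; apply: differentiableZ.
apply: differentiable_det; apply/differentiable_mxP => k l.
under eq_fun do rewrite !mxE.
by move/differentiable_mxP : dA; exact.
Qed.

Lemma is_derive_mxP m n (A : V -> 'M[R]_(m, n)) (u v : V) (dA : 'M[R]_(m, n)) :
  is_derive u v A dA <-> forall i j, is_derive u v (fun w => A w i j) (dA i j).
Proof.
split=> [[Auv AdA] i j|dAij].
  apply: DeriveDef; first by move/derivable_mxP : Auv.
  by rewrite -AdA derive_mx // mxE.
have Auv : derivable A u v.
  by apply/derivable_mxP => i j; have [] := dAij i j.
apply: DeriveDef => //; rewrite derive_mx //; apply/matrixP => i j.
by rewrite mxE; have [] := dAij i j.
Qed.

Lemma is_derive_mulmx m n p (A : V -> 'M[R]_(m, n)) (B : V -> 'M[R]_(n, p))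
    (u v : V) (dA : 'M[R]_(m, n)) (dB : 'M[R]_(n, p)) :
  is_derive u v A dA -> is_derive u v B dB ->
  is_derive u v (fun w => A w *m B w) (dA *m B u + A u *m dB).
Proof.
move=> /is_derive_mxP hA /is_derive_mxP hB; apply/is_derive_mxP => i j.
under eq_fun do rewrite mxE.
have hAB k : is_derive u v ((fun w => A w i k) * (fun w => B w k j))
    (A u i k *: dB k j + B u k j *: dA i k) by exact: is_deriveM.
have := is_derive_sum hAB; rewrite fct_sumE => /is_derive_eq; apply.
rewrite !mxE -big_split /=; apply: eq_bigr => k _ /=.
by rewrite addrC; congr (_ + _); rewrite mulrC.
Qed.

Lemma is_derive_trmx m n (A : V -> 'M[R]_(m, n)) (u v : V) (dA : 'M[R]_(m, n)) :
  is_derive u v A dA -> is_derive u v (fun w => (A w)^T) dA^T.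
Proof.
move=> /is_derive_mxP hA; apply/is_derive_mxP => i j; rewrite mxE.
by under eq_fun do rewrite mxE; exact: hA.
Qed.

Lemma is_derive_coord m n (A : V -> 'M[R]_(m, n)) (u v : V) (dA : 'M[R]_(m, n))
    i j :
  is_derive u v A dA -> is_derive u v (fun w => A w i j) (dA i j).
Proof. by move=> /is_derive_mxP. Qed.

Lemma diff_is_derive (W : normedModType R) (f : V -> W) (u v : V) :
  differentiable f u -> is_derive u v f ('D_v f u).
Proof. by move=> df; exact/derivableP/diff_derivable. Qed.

Lemma is_derive_comp_diff (U W : normedModType R) (f : V -> U) (h : U -> W)
    (u v : V) :
  differentiable f u -> differentiable h (f u) ->
  is_derive u v (fun w => h (f w)) ('D_('d f u v) h (f u)).
Proof.
move=> df dh.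
have dhf : differentiable (h \o f) u by exact: differentiable_comp.
by apply: DeriveDef; [exact: diff_derivable|rewrite !deriveE // diff_comp].
Qed.

End MatrixCalculus.

(** * Symmetry of mixed derivatives *)

Section MixedDerivatives.
Context {R : realType} {V : normedModType R}.

Lemma is_derive_along (f : V -> R) (w x : V) (s : R) :
  derivable f (s *: x + w) x ->
  is_derive s (1 : R) (fun s : R => f (s *: x + w)) ('D_x f (s *: x + w)).
Proof.
pose l (s : R) := f (s *: x + w).
have qE : (fun h : R => h^-1 *: ((l \o shift s) (h *: (1 : R)) - l s)) =
    (fun h : R => h^-1 *: ((f \o shift (s *: x + w)) (h *: x) - l s)).
  apply/funext => h /=; congr (_ *: (f _ - _)).
  by rewrite -[h *: 1]/(h * 1) mulr1 scalerDl addrA.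
move=> df; apply: DeriveDef; first by rewrite /derivable qE.
by rewrite /derive qE.
Qed.

Lemma is_derive_shift_arg (f : V -> R) (a w x : V) :
  derivable f (a + w) x ->
  is_derive w x (fun w => f (a + w)) ('D_x f (a + w)).
Proof.
have qE :
    (fun h : R => h^-1 *: (((fun w => f (a + w)) \o shift w) (h *: x)
                           - f (a + w))) =
    (fun h : R => h^-1 *: ((f \o shift (a + w)) (h *: x) - f (a + w))).
  by apply/funext => h /=; rewrite (addrCA a).
move=> df; apply: DeriveDef; first by rewrite /derivable qE.
by rewrite /derive qE.
Qed.

Lemma mean_value_along (f : V -> R) (w x : V) (h : R) : 0 < h ->
  (forall s, 0 <= s <= h -> derivable f (s *: x + w) x) ->
  exists2 s, 0 <= s <= h & f (h *: x + w) - f w = h * 'D_x f (s *: x + w).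
Proof.
move=> h0 df; pose F (s : R) : R := f (s *: x + w).
pose dF (s : R) : R := 'D_x f (s *: x + w).
have dfl (s : R) : s \in `[0, h] -> is_derive s (1 : R) F (dF s).
  by rewrite in_itv /= => /df; exact: is_derive_along.
have dfo (s : R) : s \in `]0, h[ -> is_derive s (1 : R) F (dF s).
  by move=> sh; apply: dfl; exact: subset_itv_oo_cc sh.
have cF : {within `[0, h], continuous F}.
  by apply: derivable_within_continuous => t /dfl [].
have [s sh FE] := MVT h0 dfo cF.
exists s; first by move: sh; rewrite in_itv /= => /andP[s0 sh]; rewrite !ltW.
by move: FE; rewrite /F /dF scale0r add0r subr0 mulrC.
Qed.

(** Two applications of the mean value theorem, first to the increment of [f]
    along [y], then to the derivative of [f] along [x]. *)
Lemma second_difference (f : V -> R) (u x y : V) (h : R) : 0 < h ->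
  (forall s t, 0 <= s <= h -> 0 <= t <= h ->
     derivable f (s *: x + (t *: y + u)) x /\
     derivable ('D_x f) (s *: x + (t *: y + u)) y) ->
  exists s t, [/\ 0 <= s <= h, 0 <= t <= h &
    f (h *: x + (h *: y + u)) - f (h *: x + u) - (f (h *: y + u) - f u)
    = h * (h * 'D_y ('D_x f) (s *: x + (t *: y + u)))].
Proof.
move=> h0 df.
have h0h : (0 : R) <= 0 <= h by rewrite lexx (ltW h0).
have hhh : 0 <= h <= h by rewrite lexx (ltW h0).
pose k w := f (h *: y + w) - f w.
have tE s t : s *: x + (t *: y + u) = t *: y + (s *: x + u) by rewrite addrCA.
have dk s : 0 <= s <= h -> derivable k (s *: x + u) x /\
    'D_x k (s *: x + u) = 'D_x f (h *: y + (s *: x + u)) - 'D_x f (s *: x + u).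
  move=> sh.
  have [d1 _] := df _ _ sh h0h; rewrite scale0r add0r in d1.
  have [d2 _] := df _ _ sh hhh; rewrite tE in d2.
  have [d3 dE] := is_derive_shift_arg d2.
  split; first exact: derivableB.
  by rewrite [LHS](deriveB d3 d1) dE.
have [s sh kE] := mean_value_along h0 (fun s sh => (dk s sh).1).
have [t th DE] := @mean_value_along ('D_x f) (s *: x + u) y h h0
  (fun t th => eq_ind _ (fun w => derivable _ w _) (df s t sh th).2 _ (tE s t)).
exists s, t; split; [exact: sh|exact: th|rewrite tE].
transitivity (h * 'D_x k (s *: x + u)); last first.
  by congr (h * _); rewrite (dk s sh).2 DE (tE s t).
by rewrite -kE /k.
Qed.

(** Both mixed derivatives, at suitable points, are the same second difference
    quotient of [f]; by continuity they agree in the limit. *)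
Lemma mixed_derivatives_commute (f : V -> R) (u x y : V) :
  (\forall w \near u, [/\ differentiable f w, differentiable ('D_x f) w &
                          differentiable ('D_y f) w]) ->
  {for u, continuous ('D_y ('D_x f))} -> {for u, continuous ('D_x ('D_y f))} ->
  'D_y ('D_x f) u = 'D_x ('D_y f) u.
Proof.
move=> df cyx cxy; set p := LHS; set q := RHS.
apply/eqP; rewrite -subr_eq0 -normr_le0; apply/ler_addgt0Pl => e e0.
rewrite addr0; have e2 : 0 < e / 2 by rewrite divr_gt0.
have nyx : \forall w \near u, `|p - 'D_y ('D_x f) w| < e / 2.
  exact: ((cvgrPdist_lt _ _).1 cyx).
have nxy : \forall w \near u, `|q - 'D_x ('D_y f) w| < e / 2.
  exact: ((cvgrPdist_lt _ _).1 cxy).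
have [r /= r0 rP] := (nbhs_ballP _ _).1 (filterI df (filterI nyx nxy)).
pose h := r / (`|x| + `|y| + 1).
have c0 : 0 < `|x| + `|y| + 1 by rewrite ltr_wpDl // addr_ge0.
have h0 : 0 < h by rewrite divr_gt0.
have near_u s t : 0 <= s <= h -> 0 <= t <= h ->
    ball u r (s *: x + (t *: y + u)).
  move=> /andP[s0 sh] /andP[t0 th].
  rewrite -ball_normE /= addrA opprD addrCA subrr addr0 normrN.
  apply: le_lt_trans (ler_normD _ _) _; rewrite !normrZ !ger0_norm //.
  apply: (@le_lt_trans _ _ (h * (`|x| + `|y|))).
    by rewrite mulrDr lerD // ler_wpM2r.
  by rewrite mulrAC ltr_pdivrMr // ltr_pM2l // ltrDl.
have [s [t [sh th E1]]] := @second_difference f u x y h h0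
  (fun s t sh th => let: And3 a b _ := (rP _ (near_u s t sh th)).1 in
     conj (diff_derivable a) (diff_derivable b)).
have near_u' s' t' : 0 <= s' <= h -> 0 <= t' <= h ->
    ball u r (s' *: y + (t' *: x + u)).
  by rewrite addrCA => ? ?; exact: near_u.
have [s' [t' [sh' th' E2]]] := @second_difference f u y x h h0
  (fun s t sh th => let: And3 a _ b := (rP _ (near_u' s t sh th)).1 in
     conj (diff_derivable a) (diff_derivable b)).
have [_ [+ _]] := rP _ (near_u _ _ sh th).
have [_ [_ +]] := rP _ (near_u' _ _ sh' th').
have hI : injective ( *%R h) by apply: mulfI; rewrite gt_eqF.
have -> : 'D_y ('D_x f) (s *: x + (t *: y + u)) =
    'D_x ('D_y f) (s' *: y + (t' *: x + u)).
  apply: (hI); apply: (hI); apply: etrans (esym E1) _; apply: etrans _ E2.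
  rewrite (addrCA (h *: y)).
  set a := f _; set b := f _; set c := f _; set d := f _.
  rewrite !opprB -!addrA; congr (_ + _).
  by rewrite addrCA [RHS]addrCA; congr (_ + _); rewrite addrC.
move: ('D_x _ _) => z qz pz.
apply: ltW; rewrite -(subrKA z) (splitr e).
apply: le_lt_trans (ler_normD _ _) _; apply: ltrD; first exact: pz.
by rewrite distrC; exact: qz.
Qed.

End MixedDerivatives.

Section Smooth.
Context {R : realType} {V : normedModType R}.
Implicit Types (U : set V) (u v : V).

Lemma smooth_differentiable (W : normedModType R) U (f : V -> W) u :
  smooth_on U f -> U u -> differentiable f u.
Proof. by move=> /(_ 1%N) [df _]; exact: df. Qed.

Lemma smooth_derive (W : normedModType R) U (f : V -> W) v :
  smooth_on U f -> smooth_on U ('D_v f).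
Proof. by move=> sf k; have [_] := sf k.+1; exact. Qed.

Lemma smooth_is_derive (W : normedModType R) U (f : V -> W) u v :
  smooth_on U f -> U u -> is_derive u v f ('D_v f u).
Proof.
by move=> sf Uu; apply: diff_is_derive; exact: smooth_differentiable Uu.
Qed.

Lemma eq_is_Ck (W : normedModType R) U (f h : V -> W) k : open U ->
  (forall u, U u -> f u = h u) -> is_Ck k U f -> is_Ck k U h.
Proof.
move=> Uo; elim: k f h => [|k IH] f h fh.
  move=> cf u Uu; rewrite /prop_for /continuous_at -fh //.
  apply: cvg_trans (cf u Uu); apply: near_eq_cvg.
  by apply: filterS (open_nbhs_nbhs (conj Uo Uu)) => w /fh.
have fh_near u : U u -> \near u, f u = h u.
  by move=> Uu; apply: filterS (open_nbhs_nbhs (conj Uo Uu)) => w /fh.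
move=> [df cf]; split => [u Uu|v].
  by apply: near_eq_differentiable (df u Uu); exact: fh_near.
by apply: IH (cf v) => u Uu; apply: near_eq_derive; exact: fh_near.
Qed.

Lemma smooth_coord m n U (f : V -> 'M[R]_(m, n)) i j : open U ->
  smooth_on U f -> smooth_on U (fun w => f w i j).
Proof.
move=> Uo sf k; elim: k f sf => [|k IH] f sf.
  move=> u Uu; apply: differentiable_continuous.
  by have /differentiable_mxP := smooth_differentiable sf Uu; apply.
split=> [u Uu|v].
  by have /differentiable_mxP := smooth_differentiable sf Uu; apply.
have IHv := IH ('D_v f) (smooth_derive v sf).
apply: (eq_is_Ck Uo _ IHv) => u Uu.
by have := is_derive_coord i j (smooth_is_derive v sf Uu); case.
Qed.

Lemma smooth_mixed_derivatives m n U (f : V -> 'M[R]_(m, n)) u x y : open U ->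
  smooth_on U f -> U u -> 'D_y ('D_x f) u = 'D_x ('D_y f) u.
Proof.
move=> Uo sf Uu; apply/matrixP => i j.
have coordE v (h : V -> 'M[R]_(m, n)) w : smooth_on U h -> U w ->
    'D_v (fun w => h w i j) w = ('D_v h w) i j.
  by move=> sh Uw; have := is_derive_coord i j (smooth_is_derive v sh Uw); case.
have nU := open_nbhs_nbhs (conj Uo Uu).
have coord2E v1 v2 :
    ('D_v1 ('D_v2 f) u) i j = 'D_v1 ('D_v2 (fun w => f w i j)) u.
  rewrite -coordE //; last exact: smooth_derive.
  by apply: near_eq_derive; apply: filterS nU => w Uw; rewrite coordE.
have scf := smooth_coord i j Uo sf.
have c2 v1 v2 : {for u, continuous ('D_v1 ('D_v2 (fun w => f w i j)))}.
  apply: differentiable_continuous; apply: smooth_differentiable Uu.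
  by do 2 apply: smooth_derive.
apply: etrans (coord2E y x) _; apply: etrans _ (esym (coord2E x y)).
apply: mixed_derivatives_commute; [|exact: c2|exact: c2].
apply: filterS nU => w Uw; split.
- exact: smooth_differentiable scf Uw.
- exact: smooth_differentiable (smooth_derive x scf) Uw.
- exact: smooth_differentiable (smooth_derive y scf) Uw.
Qed.

End Smooth.

(** * Bilinear forms and bilinear maps *)
Section Bilinear.
Context {R : realType}.

Section Ip.
Context {m : nat}.
Implicit Types (G : 'M[R]_m) (x y z a : 'rV[R]_m).

Lemma ipDl G x y z : ip G (x + y) z = ip G x z + ip G y z.
Proof. by rewrite /ip !mulmxDl mxE. Qed.

Lemma ipDr G x y z : ip G x (y + z) = ip G x y + ip G x z.
Proof. by rewrite /ip linearD mulmxDr mxE. Qed.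

Lemma ipZl G k x z : ip G (k *: x) z = k * ip G x z.
Proof. by rewrite /ip -!scalemxAl mxE. Qed.

Lemma ipZr G k x z : ip G x (k *: z) = k * ip G x z.
Proof. by rewrite /ip linearZ -scalemxAr mxE. Qed.

Lemma ipNl G x z : ip G (- x) z = - ip G x z.
Proof. by rewrite -scaleN1r ipZl mulN1r. Qed.

Lemma ipNr G x z : ip G x (- z) = - ip G x z.
Proof. by rewrite -scaleN1r ipZr mulN1r. Qed.

Lemma ipBl G x y z : ip G (x - y) z = ip G x z - ip G y z.
Proof. by rewrite ipDl ipNl. Qed.

Lemma ipBr G x y z : ip G x (y - z) = ip G x y - ip G x z.
Proof. by rewrite ipDr ipNr. Qed.

Lemma ip0l G z : ip G 0 z = 0.
Proof. by rewrite -(scale0r 0) ipZl mul0r. Qed.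

Lemma ip0r G z : ip G z 0 = 0.
Proof. by rewrite -(scale0r 0) ipZr mul0r. Qed.

Lemma ip_suml G I (r : seq I) (P : pred I) (f : I -> 'rV[R]_m) z :
  ip G (\sum_(i <- r | P i) f i) z = \sum_(i <- r | P i) ip G (f i) z.
Proof.
by apply: (big_morph (fun x => ip G x z) (fun x y => ipDl G x y z) (ip0l G z)).
Qed.

Lemma ip_sumr G I (r : seq I) (P : pred I) (f : I -> 'rV[R]_m) z :
  ip G z (\sum_(i <- r | P i) f i) = \sum_(i <- r | P i) ip G z (f i).
Proof. by apply: (big_morph (ip G z) (ipDr G z) (ip0r G z)). Qed.

Lemma ip_mxD (G H : 'M[R]_m) x y : ip (G + H) x y = ip G x y + ip H x y.
Proof. by rewrite /ip mulmxDr mulmxDl mxE. Qed.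

Lemma ip_mxZ k (G : 'M[R]_m) x y : ip (k *: G) x y = k * ip G x y.
Proof. by rewrite /ip -scalemxAr -scalemxAl mxE. Qed.

Lemma pairingDr a x y : pairing a (x + y) = pairing a x + pairing a y.
Proof. by rewrite /pairing linearD mulmxDr mxE. Qed.

Lemma pairingZr k a x : pairing a (k *: x) = k * pairing a x.
Proof. by rewrite /pairing linearZ -scalemxAr mxE. Qed.

Lemma posdef_unitmx G :
  (forall x, x != 0 -> 0 < ip G x x) -> G \in unitmx.
Proof.
move=> Gpos; rewrite -row_free_unit -kermx_eq0; apply/rowV0P => v.
move=> /sub_kermxP vG0; apply/eqP; apply: contraT => /Gpos.
by rewrite /ip vG0 mul0mx mxE ltxx.
Qed.

End Ip.

Definition is_bilinear2 {m k : nat} (B : 'rV[R]_m -> 'rV[R]_m -> 'rV[R]_k) :=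
  (forall y, linear (B ^~ y)) /\ (forall x, linear (B x)).

Lemma bilinear2_expand m k (B : 'rV[R]_m -> 'rV[R]_m -> 'rV[R]_k) x y :
  is_bilinear2 B ->
  B x y = \sum_i \sum_j (x 0 i * y 0 j) *: B (delta_mx 0 i) (delta_mx 0 j).
Proof.
move=> [Bl Br].
have sumE (f : 'rV[R]_m -> 'rV[R]_k) z : linear f ->
    f z = \sum_i z 0 i *: f (delta_mx 0 i).
  move=> fl; pose fM := GRing.isLinear.Build _ _ _ _ f fl.
  pose fL : {linear 'rV[R]_m -> 'rV[R]_k} := HB.pack f fM.
  rewrite -[f]/(fL : _ -> _) {1}(row_sum_delta z) linear_sum.
  by apply: eq_bigr => i _; rewrite linearZ.
rewrite (sumE (B ^~ y)) //; apply: eq_bigr => i _.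
by rewrite (sumE (B _)) // scaler_sumr; apply: eq_bigr => j _; rewrite scalerA.
Qed.

End Bilinear.

Section Bilinear2Theory.
Context {R : realType} {m k : nat}.
Variable B : 'rV[R]_m -> 'rV[R]_m -> 'rV[R]_k.
Hypothesis Bbil : is_bilinear2 B.

Lemma bilinear2_0l y : B 0 y = 0.
Proof.
have := Bbil.1 y (-1) 0 0.
by rewrite /= scaleN1r oppr0 addr0 scaleN1r addNr.
Qed.

Lemma bilinear2_0r x : B x 0 = 0.
Proof.
have := Bbil.2 x (-1) 0 0.
by rewrite /= scaleN1r oppr0 addr0 scaleN1r addNr.
Qed.

Lemma bilinear2Dr x y z : B x (y + z) = B x y + B x z.
Proof. by have := Bbil.2 x 1 y z; rewrite /= !scale1r. Qed.

Lemma bilinear2Zr a x z : B x (a *: z) = a *: B x z.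
Proof. by have := Bbil.2 x a z 0; rewrite /= bilinear2_0r !addr0. Qed.

End Bilinear2Theory.

Lemma is_derive_ip (R : realType) (V : normedModType R) m
    (G : V -> 'M[R]_m) (a b : V -> 'rV[R]_m) (u v : V) dG da db :
  is_derive u v G dG -> is_derive u v a da -> is_derive u v b db ->
  is_derive u v (fun w => ip (G w) (a w) (b w))
    (ip dG (a u) (b u) + ip (G u) da (b u) + ip (G u) (a u) db).
Proof.
move=> hG ha hb.
have h := is_derive_mulmx (is_derive_mulmx ha hG) (is_derive_trmx hb).
apply: (is_derive_eq (is_derive_coord 0 0 h)).
by rewrite mxE mulmxDl mxE (addrC (ip dG _ _)).
Qed.

Section DeriveBilinear.
Context {R : realType} {V : normedModType R}.

Lemma is_derive_scale m (k : V -> R) (f : V -> 'rV[R]_m) (u v : V) dk df :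
  is_derive u v k dk -> is_derive u v f df ->
  is_derive u v (fun w => k w *: f w) (dk *: f u + k u *: df).
Proof.
move=> hk /is_derive_mxP hf; apply/is_derive_mxP => i j.
under eq_fun do rewrite mxE.
apply: (is_derive_eq (is_deriveM hk (hf i j))).
by rewrite !mxE addrC; congr (_ + _); rewrite [LHS]mulrC.
Qed.

Lemma is_derive_bigsum n (W : normedModType R) (f : 'I_n -> V -> W)
    (u v : V) df :
  (forall i, is_derive u v (f i) (df i)) ->
  is_derive u v (fun w => \sum_i f i w) (\sum_i df i).
Proof. by move=> hf; have := is_derive_sum hf; rewrite fct_sumE. Qed.

End DeriveBilinear.

(** Product rule for a bilinear map whose coefficients depend on the base point,
    as Christoffel symbols along [F] do; expanding both arguments on the
    standard basis reduces it to products of scalar functions. *)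
Lemma is_derive_bilinear_comp (R : realType) (V : normedModType R) m k q
    (Gam : 'rV[R]_q -> 'rV[R]_m -> 'rV[R]_m -> 'rV[R]_k)
    (F : V -> 'rV[R]_q) (a b : V -> 'rV[R]_m) (u v : V) da db :
  (\forall z \near F u, is_bilinear2 (Gam z)) ->
  (forall x y, differentiable (fun z => Gam z x y) (F u)) ->
  differentiable F u -> is_derive u v a da -> is_derive u v b db ->
  is_derive u v (fun w => Gam (F w) (a w) (b w))
    ('D_('d F u v) (fun z => Gam z (a u) (b u)) (F u)
     + Gam (F u) da (b u) + Gam (F u) (a u) db).
Proof.
move=> Gbil Gdiff dF ha hb; have GFu := nbhs_singleton Gbil.
pose G i j z := Gam z (delta_mx 0 i) (delta_mx 0 j).
have GE : \forall z \near F u, forall x y,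
    Gam z x y = \sum_i \sum_j (x 0 i * y 0 j) *: G i j z.
  by apply: filterS Gbil => z zb x y; rewrite (bilinear2_expand _ _ zb).
have DGE x y w : 'D_w (fun z => Gam z x y) (F u) =
    \sum_i \sum_j (x 0 i * y 0 j) *: 'D_w (G i j) (F u).
  pose S z := \sum_i \sum_j (x 0 i * y 0 j) *: G i j z.
  have hS : is_derive (F u) w S
      (\sum_i \sum_j (x 0 i * y 0 j) *: 'D_w (G i j) (F u)).
    have hZ i j : is_derive (F u) w (fun z => (x 0 i * y 0 j) *: G i j z)
        ((x 0 i * y 0 j) *: 'D_w (G i j) (F u)).
      exact: (is_deriveZ (x 0 i * y 0 j) (diff_is_derive w (Gdiff _ _))).
    exact: (is_derive_bigsum (fun i => is_derive_bigsum (hZ i))).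
  rewrite (near_eq_derive (g := S)); first by case: hS.
  by apply: filterS GE => z ->.
have cF : {for u, continuous F} by exact: differentiable_continuous.
have GFE : \forall w \near u,
    \sum_i \sum_j (a w 0 i * b w 0 j) *: G i j (F w) = Gam (F w) (a w) (b w).
  have FGE : \forall w \near u, forall x y,
      Gam (F w) x y = \sum_i \sum_j (x 0 i * y 0 j) *: G i j (F w).
    exact: cF GE.
  by apply: filterS FGE => w GwE; rewrite GwE.
apply: (near_eq_is_derive GFE).
have hij i j : is_derive u v (fun w => (a w 0 i * b w 0 j) *: G i j (F w))
    ((a u 0 i * db 0 j + b u 0 j * da 0 i) *: G i j (F u)
     + (a u 0 i * b u 0 j) *: 'D_('d F u v) (G i j) (F u)).
  apply: (is_derive_scale _ (is_derive_comp_diff v dF (Gdiff _ _))).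
  exact: (is_deriveM (is_derive_coord 0 i ha) (is_derive_coord 0 j hb)).
have hS := is_derive_bigsum (fun i => is_derive_bigsum (hij i)).
apply: (is_derive_eq hS).
rewrite DGE (bilinear2_expand da (b u) GFu) (bilinear2_expand (a u) db GFu).
rewrite -!big_split; apply: eq_bigr => i _ /=.
rewrite -!big_split; apply: eq_bigr => j _ /=.
move: ('D_ _ _ _) => D; rewrite scalerDl addrC -!addrA; congr (_ + _).
by rewrite addrC (mulrC (b u 0 j)).
Qed.

Section BilinearDifferentiable.
Context {R : realType} {V : normedModType R}.

Lemma differentiable_bilinear_comp m k q
    (Gam : 'rV[R]_q -> 'rV[R]_m -> 'rV[R]_m -> 'rV[R]_k)
    (F : V -> 'rV[R]_q) (a b : V -> 'rV[R]_m) (u : V) :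
  (\forall z \near F u, is_bilinear2 (Gam z)) ->
  (forall x y, differentiable (fun z => Gam z x y) (F u)) ->
  differentiable F u -> differentiable a u -> differentiable b u ->
  differentiable (fun w => Gam (F w) (a w) (b w)) u.
Proof.
move=> Gbil Gdiff dF /differentiable_mxP da /differentiable_mxP db.
have cF : {for u, continuous F} by exact: differentiable_continuous.
have GF : \forall w \near u, is_bilinear2 (Gam (F w)) by exact: cF Gbil.
have GFE : \forall w \near u,
    \sum_i \sum_j (a w 0 i * b w 0 j) *: Gam (F w) (delta_mx 0 i) (delta_mx 0 j)
    = Gam (F w) (a w) (b w).
  by apply: filterS GF => w Gw; rewrite [RHS](bilinear2_expand _ _ Gw).
apply: (near_eq_differentiable GFE); apply: differentiable_bigsum => i.
apply: differentiable_bigsum => j; apply/differentiable_mxP => r s.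
under eq_fun do rewrite mxE.
apply: differentiableM; first by apply: differentiableM; [exact: da|exact: db].
have dGF := differentiable_comp dF (Gdiff (delta_mx 0 i) (delta_mx 0 j)).
by move/differentiable_mxP : dGF; exact.
Qed.

End BilinearDifferentiable.

(** * Orthonormal frames *)

Section Frames.
Context {R : realType} {m : nat}.
Variables (G : 'M[R]_m) (e : 'I_m -> 'rV[R]_m).
Hypothesis e_orth : forall i j, ip G (e i) (e j) = (i == j)%:R.

(** Orthonormality says [E G E^T = 1], so [E] is invertible and [G E^T E = 1]:
    the frame spans. *)
Lemma frame_expand x : x = \sum_i ip G x (e i) *: e i.
Proof.
pose E : 'M[R]_m := \matrix_i e i.
have EGE : E *m (G *m E^T) = 1%:M.
  apply/matrixP => i j; rewrite mulmxA [RHS]mxE -e_orth /ip [LHS]mxE [RHS]mxE.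
  apply: eq_bigr => k _; rewrite [E^T _ _]mxE [E _ _]mxE [(e j)^T _ _]mxE.
  congr (_ * _); rewrite [LHS]mxE [RHS]mxE.
  by apply: eq_bigr => l _; rewrite [E _ _]mxE.
have := mulmx1C EGE => GEE.
rewrite -[LHS]mulmx1 -GEE !mulmxA mulmx_sum_row; apply: eq_bigr => i _.
rewrite rowK; congr (_ *: _); rewrite /ip [LHS]mxE [RHS]mxE.
by apply: eq_bigr => k _; rewrite [E^T _ _]mxE [E _ _]mxE [(e i)^T _ _]mxE.
Qed.

Lemma parseval x y : ip G x y = \sum_i ip G x (e i) * ip G y (e i).
Proof.
rewrite {1}(frame_expand y) ip_sumr; apply: eq_bigr => i _.
by rewrite ipZr mulrC.
Qed.

End Frames.

(** Expanding [e'] in [e], the coefficient of [B(e_j, e_k)] becomes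
    [sum_i <e'_i, e_j> <e'_i, e_k>], which is [delta_jk] by Parseval for
    [e']. *)
Lemma frame_trace (R : realType) m (G : 'M[R]_m) (e e' : 'I_m -> 'rV[R]_m)
    (B : 'rV[R]_m -> 'rV[R]_m -> R) :
  G^T = G ->
  (forall i j, ip G (e i) (e j) = (i == j)%:R) ->
  (forall i j, ip G (e' i) (e' j) = (i == j)%:R) ->
  (forall k x y z, B (k *: x + y) z = k * B x z + B y z) ->
  (forall k x y z, B x (k *: y + z) = k * B x y + B x z) ->
  \sum_i B (e' i) (e' i) = \sum_i B (e i) (e i).
Proof.
move=> G_sym e_orth e'_orth Bl Br.
have sumE (f : 'rV[R]_m -> R) (c : 'I_m -> R) :
    (forall k x y, f (k *: x + y) = k * f x + f y) ->
    f (\sum_i c i *: e i) = \sum_i c i * f (e i).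
  move=> fl; have f0 : f 0 = 0.
    by have := fl (-1) 0 0; rewrite scaler0 addr0 mulN1r addNr.
  by elim/big_rec2 : _ => // i y1 y2 _ <-; rewrite fl.
have BE x : B x x = \sum_j \sum_k ip G x (e j) * ip G x (e k) * B (e j) (e k).
  rewrite {1 2}(frame_expand e_orth x) (sumE (B ^~ _)) //.
  apply: eq_bigr => j _; rewrite (sumE (B _)) // mulr_sumr.
  by apply: eq_bigr => k _; rewrite mulrA.
rewrite (eq_bigr _ (fun i _ => BE (e' i))) exchange_big.
apply: eq_bigr => j _ /=.
rewrite exchange_big; transitivity (\sum_k (j == k)%:R * B (e j) (e k)).
  apply: eq_bigr => k _; rewrite -mulr_suml -e_orth; congr (_ * _).
  rewrite (parseval e'_orth); apply: eq_bigr => i _.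
  by rewrite !(ip_sym (e' i) _ G_sym).
rewrite (bigD1 j) //= eqxx mul1r big1 ?addr0 // => k /negPf.
by rewrite eq_sym => ->; rewrite mul0r.
Qed.

(** Adjoining tangent vectors completes a normal frame to an orthonormal basis
    of the ambient space, on which vectors normal to them have no component. *)
Lemma parseval_normal (R : realType) n p m (G : 'M[R]_m)
    (t : 'I_n -> 'rV[R]_m) (nu : 'I_p -> 'rV[R]_m) (x y : 'rV[R]_m) :
  m = (n + p)%N -> G^T = G ->
  (forall i j, ip G (t i) (t j) = (i == j)%:R) ->
  (forall a b, ip G (nu a) (nu b) = (a == b)%:R) ->
  (forall a i, ip G (nu a) (t i) = 0) ->
  (forall i, ip G x (t i) = 0) ->
  ip G x y = \sum_a ip G x (nu a) * ip G y (nu a).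
Proof.
move=> mE; subst m => G_sym tt nn nt xt.
pose E (i : 'I_(n + p)) :=
  match fintype.split i with inl j => t j | inr a => nu a end.
have El j : E (lshift p j) = t j.
  by rewrite /E -[lshift p j]/(unsplit (inl j)) unsplitK.
have Er a : E (rshift n a) = nu a.
  by rewrite /E -[rshift n a]/(unsplit (inr a)) unsplitK.
have E_orth i j : ip G (E i) (E j) = (i == j)%:R.
  case: (split_ordP i) => [i' ->|a ->]; case: (split_ordP j) => [j' ->|b ->];
    rewrite ?El ?Er eq_shift.
  - exact: tt.
  - by rewrite ip_sym.
  - exact: nt.
  - exact: nn.
rewrite (parseval E_orth) big_split_ord /= big1 ?add0r => [|i _].
  by apply: eq_bigr => a _; rewrite Er.
by rewrite El xt mul0r.
Qed.

(** * Ricci-type sums of symmetric matrices *)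

Section RicciMatrix.
Context {R : realType}.

(** The squared norm is split so that [q] and [r] vanish exactly when the matrix
    is [diag(a, mu, .., mu)]; [r] is a variance, hence the term
    [k mu^2] left over from the lower block. *)
Lemma sum_sqr_decomp k (A : 'M[R]_k.+1) : (0 < k)%N -> A^T = A ->
  let mu := k%:R^-1 * \sum_(j < k) A (lift ord0 j) (lift ord0 j) in
  let q := \sum_(j < k) A ord0 (lift ord0 j) ^+ 2 in
  let r := \sum_(i < k) \sum_(j < k)
    (A (lift ord0 i) (lift ord0 j) - mu *+ (i == j)) ^+ 2 in
  [/\ \sum_i A i i = A ord0 ord0 + k%:R * mu,
      \sum_j A ord0 j ^+ 2 = A ord0 ord0 ^+ 2 + q &
      \sum_i \sum_j A i j ^+ 2 = A ord0 ord0 ^+ 2 + 2 * q + k%:R * mu ^+ 2 + r].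
Proof.
move=> k0 AT mu q r; have kN0 : k%:R != 0 :> R by rewrite pnatr_eq0 -lt0n.
have muE : \sum_(j < k) A (lift ord0 j) (lift ord0 j) = k%:R * mu.
  by rewrite mulrA mulfV // mul1r.
split; rewrite big_ord_recl ?muE //.
rewrite big_ord_recl -/q.
have -> : \sum_(i < k) \sum_(j < k.+1) A (lift ord0 i) j ^+ 2 =
    q + \sum_(i < k) \sum_(j < k) A (lift ord0 i) (lift ord0 j) ^+ 2.
  rewrite /q -big_split /=; apply: eq_bigr => i _; rewrite big_ord_recl /=.
  by congr (_ ^+ 2 + _); rewrite -{1}AT mxE.
suff -> : r = \sum_(i < k) \sum_(j < k) A (lift ord0 i) (lift ord0 j) ^+ 2
    - k%:R * mu ^+ 2 by ring.
have rE i : \sum_(j < k) (A (lift ord0 i) (lift ord0 j) - mu *+ (i == j)) ^+ 2 =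
    \sum_(j < k) A (lift ord0 i) (lift ord0 j) ^+ 2
    + (mu ^+ 2 - 2 * mu * A (lift ord0 i) (lift ord0 i)).
  rewrite (bigD1 i) //= eqxx [in RHS](bigD1 i) //= mulr1n.
  rewrite (eq_bigr (fun j => A (lift ord0 i) (lift ord0 j) ^+ 2)); last first.
    by move=> j /negPf; rewrite eq_sym => ->; rewrite mulr0n subr0.
  by ring.
rewrite /r (eq_bigr _ (fun i _ => rE i)) big_split /=; congr (_ + _).
rewrite sumrB sumr_const card_ord -mulr_sumr muE -mulr_natl; ring.
Qed.

(** At the shape matrix [sff_mx] of a normal vector, [mx_mean], [mx_norm2] and
    [mx_gap] are convertible to [mean_comp], [sff_norm2] and [eig_gap]. *)
Definition mx_mean n (A : 'M[R]_n) : R := n%:R^-1 * \sum_i A i i.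
Definition mx_norm2 n (A : 'M[R]_n) : R := \sum_i \sum_j A i j ^+ 2.
Definition mx_gap n (A : 'M[R]_n) : R :=
  Num.sqrt ((n%:R * mx_norm2 A - n%:R ^+ 2 * mx_mean A ^+ 2) / (n%:R - 1)).

(** The part of the Ricci sum that comes from one normal direction with shape
    matrix [A], minus the value of [scrH] at the mean and norm of [A]. *)
Definition ricci_excess k (A : 'M[R]_k.+1) : R :=
  A ord0 ord0 * \sum_i A i i - \sum_j A ord0 j ^+ 2
  - (k.+1%:R - 1) / k.+1%:R * (2 * k.+1%:R * mx_mean A ^+ 2 - mx_norm2 A
      - (k.+1%:R - 2) * `|mx_mean A| * mx_gap A).

Definition eig_sign n (A : 'M[R]_n) (eps : R) : Prop :=
  (mx_mean A != 0 -> eps = Num.sg (mx_mean A)) /\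
  (mx_mean A = 0 -> eps = 1 \/ eps = -1).

Definition two_eig_mx n (A : 'M[R]_n) (eps : R) : 'M[R]_n :=
  \matrix_(i, j) (if i == j then
    if i == 0%N :> nat then mx_mean A - (n%:R - 1) / n%:R * eps * mx_gap A
    else mx_mean A + n%:R^-1 * eps * mx_gap A
  else 0).

Section Excess.
Variables (k : nat) (A : 'M[R]_k.+1).
Hypotheses (k_gt1 : (1 < k)%N) (A_sym : A^T = A).

Let a := A ord0 ord0.
Let mu := k%:R^-1 * \sum_(j < k) A (lift ord0 j) (lift ord0 j).
Let q := \sum_(j < k) A ord0 (lift ord0 j) ^+ 2.
Let r := \sum_(i < k) \sum_(j < k)
    (A (lift ord0 i) (lift ord0 j) - mu *+ (i == j)) ^+ 2.
Let h := mx_mean A.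
Let D := mx_gap A.
Let n : R := k.+1%:R.

Let k_ge2 : 2 <= k%:R :> R. Proof. by rewrite ler_nat. Qed.
Let nE : n = k%:R + 1. Proof. by rewrite /n -natr1. Qed.
Let kN0 : k%:R != 0 :> R.
Proof. by rewrite pnatr_eq0 -lt0n (ltnW k_gt1). Qed.
Let n1N0 : k%:R + 1 != 0 :> R. Proof. by rewrite natr1 pnatr_eq0. Qed.
Let n_gt0 : 0 < n. Proof. by rewrite ltr0n. Qed.
Let q_ge0 : 0 <= q. Proof. by apply: sumr_ge0 => j _; exact: sqr_ge0. Qed.
Let r_ge0 : 0 <= r.
Proof. by do 2 apply: sumr_ge0 => ? _; exact: sqr_ge0. Qed.

Let decomp : [/\ \sum_i A i i = a + k%:R * mu,
  \sum_j A ord0 j ^+ 2 = a ^+ 2 + q &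
  mx_norm2 A = a ^+ 2 + 2 * q + k%:R * mu ^+ 2 + r].
Proof. exact: sum_sqr_decomp (ltnW k_gt1) A_sym. Qed.

Let meanE : n * h = a + k%:R * mu.
Proof.
by rewrite /h /mx_mean mulrA mulfV ?mul1r ?gt_eqF //; have [-> _ _] := decomp.
Qed.

Let hE : h = (a + k%:R * mu) / n.
Proof. by rewrite -meanE mulrAC mulfV ?mul1r // gt_eqF. Qed.

Let gapE2 : (n * mx_norm2 A - n ^+ 2 * h ^+ 2) / (n - 1) =
  (a - mu) ^+ 2 + n * (2 * q + r) / k%:R.
Proof.
have -> : n ^+ 2 * h ^+ 2 = (a + k%:R * mu) ^+ 2.
  by rewrite -meanE [RHS]exprMn.
have [_ _ SE] := decomp; rewrite SE nE addrK.
by field; rewrite ?kN0 ?n1N0.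
Qed.

Let gap_ge0 : 0 <= D. Proof. exact: sqrtr_ge0. Qed.

Lemma mx_gap_sqr : mx_gap A ^+ 2 =
  (n * mx_norm2 A - n ^+ 2 * mx_mean A ^+ 2) / (n - 1).
Proof.
rewrite sqr_sqrtr // -/n -/h gapE2.
rewrite addr_ge0 ?sqr_ge0 // divr_ge0 ?ler0n // mulr_ge0 ?(ltW n_gt0) //.
by rewrite addr_ge0 // mulr_ge0.
Qed.

Let gapE : D ^+ 2 = (a - mu) ^+ 2 + n * (2 * q + r) / k%:R.
Proof. by rewrite mx_gap_sqr gapE2. Qed.

Let gap_ge : `|a - mu| <= D.
Proof.
rewrite -(ler_pXn2r (n := 2)) ?nnegrE // gapE real_normK ?num_real // lerDl.
by rewrite divr_ge0 ?ler0n // mulr_ge0 ?(ltW n_gt0) // addr_ge0 // mulr_ge0.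
Qed.

Let cross_ge0 : 0 <= h * (a - mu) + `|h| * D.
Proof.
have : `|h * (a - mu)| <= `|h| * D by rewrite normrM ler_wpM2l.
by rewrite ler_norml => /andP[]; lra.
Qed.

(** All three terms are nonnegative. With [n = k + 1], the coefficient of [q] is
    [2 k / n - 1]: it is positive only because [n >= 3]. *)
Let excessE : ricci_excess A =
  (k%:R - 1) * (k%:R / n) * (h * (a - mu) + `|h| * D)
  + (k%:R - 1) / n * q + k%:R / n * r.
Proof.
have [E1 E2 E3] := decomp.
rewrite /ricci_excess E1 E2 E3 -/a -/n -/h -/D hE.
by move: `|_| => hh; rewrite nE; field; rewrite ?kN0 ?n1N0.
Qed.

Lemma ricci_excess_ge0 : 0 <= ricci_excess A.
Proof.
have := k_ge2 => k2; have k1 : 0 <= k%:R - 1 :> R by lra.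
rewrite excessE !addr_ge0 // !mulr_ge0 ?invr_ge0 ?ler0n //.
Qed.

Lemma ricci_excess_eq0 :
  ricci_excess A = 0 <-> exists2 eps, eig_sign A eps & A = two_eig_mx A eps.
Proof.
have := k_ge2 => k2; have k1 : 0 < k%:R - 1 :> R by lra.
have k0 : 0 < k%:R :> R by lra.
split=> [|[eps [eps1 eps2] AE]].
  rewrite excessE.
  set c1 := _ * (h * _ + _); set c2 := _ * q; set c3 := _ * r => c0.
  have kn0 : 0 < k%:R / n by rewrite divr_gt0.
  have kn1 : 0 < (k%:R - 1) / n by rewrite divr_gt0.
  have c1_ge0 : 0 <= c1 := mulr_ge0 (mulr_ge0 (ltW k1) (ltW kn0)) cross_ge0.
  have c2_ge0 : 0 <= c2 := mulr_ge0 (ltW kn1) q_ge0.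
  have c3_ge0 : 0 <= c3 := mulr_ge0 (ltW kn0) r_ge0.
  have cross0 : h * (a - mu) + `|h| * D = 0.
    have : c1 = 0 by lra.
    by move=> /eqP; rewrite mulf_eq0 (gt_eqF (mulr_gt0 k1 kn0)) => /eqP.
  have q0 : q = 0.
    have : c2 = 0 by lra.
    by move=> /eqP; rewrite mulf_eq0 (gt_eqF kn1) => /eqP.
  have r0 : r = 0.
    have : c3 = 0 by lra.
    by move=> /eqP; rewrite mulf_eq0 (gt_eqF kn0) => /eqP.
  have DE : D = `|a - mu|.
    have := gapE; rewrite q0 r0 mulr0 addr0 mulr0 mul0r addr0 => D2.
    by rewrite -(ger0_norm gap_ge0) -!sqrtr_sqr D2.
  have q0j j : A ord0 (lift ord0 j) = 0.
    apply/eqP; rewrite -sqrf_eq0; apply/eqP.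
    have := psumr_eq0P (fun i _ => sqr_ge0 (A ord0 (lift ord0 i))) q0.
    by move/(_ j isT).
  have r0j i j : A (lift ord0 i) (lift ord0 j) = mu *+ (i == j).
    have row_ge0 i' : 0 <= \sum_(j < k)
        (A (lift ord0 i') (lift ord0 j) - mu *+ (i' == j)) ^+ 2.
      by apply: sumr_ge0 => l _; exact: sqr_ge0.
    have := psumr_eq0P (fun i' _ => row_ge0 i') r0; move=> /(_ i isT) ri0.
    have := psumr_eq0P (fun j _ => sqr_ge0 _) ri0; move=> /(_ j isT)/eqP.
    by rewrite sqrf_eq0 subr_eq0 => /eqP.
  have [eps eps_sign aE] : exists2 eps, eig_sign A eps & a - mu = - (eps * D).
    (* For [h = 0] the sign is free, and is chosen opposite to [a - mu]. *)
    have [h0|hN0] := eqVneq h 0.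
      have [s|s] := leP 0 (a - mu).
        exists (-1); first by split=> [|_]; [rewrite -/h h0 eqxx|right].
        by rewrite DE ger0_norm // mulN1r opprK.
      exists 1; first by split=> [|_]; [rewrite -/h h0 eqxx|left].
      by rewrite DE ltr0_norm // mul1r opprK.
    exists (Num.sg h).
      by split=> // /eqP; rewrite -/h (negPf hN0).
    apply: (mulfI hN0); apply: (addIr (`|h| * D)).
    by rewrite cross0 [in RHS]normrEsg mulrN mulrA [h * _]mulrC addNr.
  exists eps => //.
  have aE' : a = h - (n - 1) / n * eps * D.
    rewrite hE.
    have -> : a = mu - eps * D by lra.
    by rewrite nE; field; rewrite ?kN0 ?n1N0.
  have muE' : mu = h + n^-1 * eps * D.
    rewrite hE.
    have -> : a = mu - eps * D by lra.
    by rewrite nE; field; rewrite ?kN0 ?n1N0.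
  apply/matrixP => i j; rewrite mxE -/h -/D -/n -aE' -muE'.
  have [i' ->|->] := unliftP ord0 i; have [j' ->|->] := unliftP ord0 j => //=.
  - by rewrite r0j (inj_eq lift_inj); case: eqP.
  - by rewrite -A_sym mxE q0j.
have aE : a = h - (n - 1) / n * eps * D by rewrite /a {1}AE mxE eqxx.
have djE j : A (lift ord0 j) (lift ord0 j) = h + n^-1 * eps * D.
  by rewrite {1}AE mxE eqxx.
have muE : mu = h + n^-1 * eps * D.
  rewrite /mu (eq_bigr _ (fun j _ => djE j)) sumr_const card_ord.
  by rewrite -[X in _ * X]mulr_natl mulrA mulVf ?mul1r // gt_eqF.
have q0 : q = 0.
  rewrite /q big1 // => j _; rewrite {1}AE mxE (negPf (neq_lift _ _)).
  by rewrite expr0n.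
have r0 : r = 0.
  rewrite /r big1 // => i _; rewrite big1 // => j _.
  rewrite {1}AE mxE -/h -/D -/n (inj_eq lift_inj) -muE.
  by case: eqP => _ /=; rewrite ?mulr1n ?mulr0n subrr expr0n.
have amuE : a - mu = - (eps * D).
  by rewrite aE muE nE; field; rewrite ?kN0 ?n1N0.
rewrite excessE q0 r0 amuE !mulr0 !addr0.
suff -> : h * - (eps * D) + `|h| * D = 0 by rewrite mulr0.
have [h0|hN0] := eqVneq h 0; first by rewrite h0 normr0 !mul0r addr0.
by rewrite (eps1 hN0) [in X in _ + X]normrEsg mulrN mulrA [h * _]mulrC addNr.
Qed.

End Excess.
End RicciMatrix.

Section FormMatrix.
Context {R : realType} {m : nat}.
Variables (G : 'M[R]_m) (b : 'rV[R]_m -> 'rV[R]_m -> R).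
Variables (e e' : 'I_m -> 'rV[R]_m).
Hypothesis G_sym : G^T = G.
Hypothesis e_orth : forall i j, ip G (e i) (e j) = (i == j)%:R.
Hypothesis e'_orth : forall i j, ip G (e' i) (e' j) = (i == j)%:R.
Hypothesis b_sym : forall x y, b x y = b y x.
Hypothesis bDl : forall k x y z, b (k *: x + y) z = k * b x z + b y z.

Definition form_mx (d : 'I_m -> 'rV[R]_m) : 'M[R]_m :=
  \matrix_(i, j) b (d i) (d j).

Let bDr k x y z : b x (k *: y + z) = k * b x y + b x z.
Proof. by rewrite !(b_sym x) bDl. Qed.

Lemma mean_frame : mx_mean (form_mx e') = mx_mean (form_mx e).
Proof.
congr (_ * _).
have E d : \sum_i form_mx d i i = \sum_i b (d i) (d i).
  by apply: eq_bigr => i _; rewrite mxE.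
by rewrite !E; exact: frame_trace G_sym e_orth e'_orth bDl bDr.
Qed.

Let row_frame x : \sum_j b x (e' j) ^+ 2 = \sum_j b x (e j) ^+ 2.
Proof.
apply: (frame_trace (B := fun y z => b x y * b x z) G_sym e_orth e'_orth).
  by move=> k y z w; rewrite bDr; ring.
by move=> k y z w; rewrite bDr; ring.
Qed.

(** The frame is changed in one argument of [b] at a time. *)
Lemma norm2_frame : mx_norm2 (form_mx e') = mx_norm2 (form_mx e).
Proof.
have E d : mx_norm2 (form_mx d) = \sum_i \sum_j b (d i) (d j) ^+ 2.
  by apply: eq_bigr => i _; apply: eq_bigr => j _; rewrite mxE.
rewrite !E (eq_bigr _ (fun i _ => row_frame (e' i))) exchange_big.
apply: eq_bigr => i _.
have sqE j (_ : true) := congr1 (fun c => c ^+ 2) (b_sym (e' j) (e i)).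
by rewrite (eq_bigr _ sqE).
Qed.

Lemma gap_frame : mx_gap (form_mx e') = mx_gap (form_mx e).
Proof. by rewrite /mx_gap norm2_frame mean_frame. Qed.

Lemma row_norm_frame i : e' i = e i ->
  \sum_j form_mx e' i j ^+ 2 = \sum_j form_mx e i j ^+ 2.
Proof.
have E d : \sum_j form_mx d i j ^+ 2 = \sum_j b (d i) (d j) ^+ 2.
  by apply: eq_bigr => j _; rewrite mxE.
by move=> ei; rewrite !E ei.
Qed.

End FormMatrix.

Lemma ricci_excess_frame (R : realType) k (G : 'M[R]_k.+1)
    (b : 'rV[R]_k.+1 -> 'rV[R]_k.+1 -> R) (e e' : 'I_k.+1 -> 'rV[R]_k.+1) :
  G^T = G ->
  (forall i j, ip G (e i) (e j) = (i == j)%:R) ->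
  (forall i j, ip G (e' i) (e' j) = (i == j)%:R) ->
  (forall x y, b x y = b y x) ->
  (forall k x y z, b (k *: x + y) z = k * b x z + b y z) ->
  e' ord0 = e ord0 ->
  ricci_excess (form_mx b e') = ricci_excess (form_mx b e).
Proof.
move=> Gs eo eo' bs bl e0.
have meanE := mean_frame Gs eo eo' bs bl.
have trE : \sum_i form_mx b e' i i = \sum_i form_mx b e i i.
  by apply: (mulfI (_ : k.+1%:R^-1 != 0)) => //; rewrite invr_eq0 pnatr_eq0.
rewrite /ricci_excess meanE (gap_frame Gs eo eo' bs bl).
rewrite (norm2_frame Gs eo eo' bs bl) trE (row_norm_frame Gs eo eo' bs bl e0).
by rewrite [form_mx b e' _ _]mxE e0 [form_mx b e _ _]mxE.
Qed.

Section CauchySchwarz.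
Context {R : realType} {p : nat}.
Variables x y : 'I_p -> R.
Hypotheses (x_ge0 : forall a, 0 <= x a) (y_ge0 : forall a, 0 <= y a).

Let X := \sum_a x a ^+ 2.
Let Y := \sum_a y a ^+ 2.
Let Z := \sum_a x a * y a.

Let X_ge0 : 0 <= X. Proof. by apply: sumr_ge0 => a _; exact: sqr_ge0. Qed.
Let Y_ge0 : 0 <= Y. Proof. by apply: sumr_ge0 => a _; exact: sqr_ge0. Qed.
Let Z_ge0 : 0 <= Z. Proof. by apply: sumr_ge0 => a _; exact: mulr_ge0. Qed.

(** Up to the factor [X], [X y - Z x] is the component of [y] orthogonal to
    [x]. *)
Let lagrange : \sum_a (X * y a - Z * x a) ^+ 2 = X * (X * Y - Z ^+ 2).
Proof.
have expand c d : \sum_a (c * y a - d * x a) ^+ 2 =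
    c ^+ 2 * Y - 2 * c * d * Z + d ^+ 2 * X.
  rewrite /X /Y /Z !mulr_sumr -sumrB -big_split.
  by apply: eq_bigr => a _ /=; ring.
by rewrite expand; ring.
Qed.

Let X0_x : X = 0 -> forall a, x a = 0.
Proof.
move=> X0 a; apply/eqP; rewrite -sqrf_eq0; apply/eqP.
have := psumr_eq0P (fun a _ => sqr_ge0 (x a)) X0.
by move/(_ a isT).
Qed.

Let X0_Z : X = 0 -> Z = 0.
Proof. by move=> /X0_x x0; rewrite /Z big1 // => a _; rewrite x0 mul0r. Qed.

Lemma sum_mul_le_sqrt : Z <= Num.sqrt X * Num.sqrt Y.
Proof.
have [X0|XN0] := eqVneq X 0; first by rewrite X0_Z // mulr_ge0 ?sqrtr_ge0.
have X_gt0 : 0 < X by rewrite lt_def XN0 X_ge0.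
rewrite -sqrtrM // -(ger0_norm Z_ge0) -sqrtr_sqr ler_sqrt ?mulr_ge0 //.
rewrite -subr_ge0 -(pmulr_rge0 _ X_gt0) -lagrange.
by apply: sumr_ge0 => a _; exact: sqr_ge0.
Qed.

Lemma sum_mul_eq_sqrt :
  Z = Num.sqrt X * Num.sqrt Y <->
  (X != 0 -> exists2 rho, 0 <= rho & forall a, y a = rho * x a).
Proof.
split=> [ZE XN0|].
  have X_gt0 : 0 < X by rewrite lt_def XN0 X_ge0.
  exists (Z / X) => [|a]; first exact: divr_ge0.
  have lag0 : \sum_a (X * y a - Z * x a) ^+ 2 = 0.
    by rewrite lagrange ZE exprMn !sqr_sqrtr // subrr mulr0.
  have := psumr_eq0P (fun a _ => sqr_ge0 (X * y a - Z * x a)) lag0.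
  move/(_ a isT)/eqP; rewrite sqrf_eq0 subr_eq0 => /eqP XyE.
  by apply: (mulfI XN0); rewrite XyE mulrCA mulrA divfK // mulrC.
have [X0 _|XN0 /(_ isT) [rho rho0 yE]] := eqVneq X 0.
  by rewrite X0_Z // X0 sqrtr0 mul0r.
have ZE : Z = rho * X.
  by rewrite mulr_sumr; apply: eq_bigr => a _; rewrite yE; ring.
have YE : Y = rho ^+ 2 * X.
  by rewrite mulr_sumr; apply: eq_bigr => a _; rewrite yE; ring.
rewrite ZE YE sqrtrM ?sqr_ge0 // sqrtr_sqr ger0_norm // mulrCA.
by rewrite -expr2 sqr_sqrtr.
Qed.

End CauchySchwarz.

Section SumExcess.
Context {R : realType} {p k : nat}.
Variable A : 'I_p -> 'M[R]_k.+1.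
Hypotheses (k_gt1 : (1 < k)%N) (A_sym : forall a, (A a)^T = A a).

Let n : R := k.+1%:R.
Let h := Num.sqrt (\sum_a mx_mean (A a) ^+ 2).
Let S := \sum_a mx_norm2 (A a).
Let Q := \sum_a (A a ord0 ord0 * (\sum_i A a i i) - \sum_j A a ord0 j ^+ 2).
Let defect := h * Num.sqrt (\sum_a mx_gap (A a) ^+ 2)
  - \sum_a `|mx_mean (A a)| * mx_gap (A a).

Let n_ge3 : 3 <= n. Proof. by rewrite /n ler_nat. Qed.

(** Adding up the directions replaces [sum_a |H^a| D_a] by its Cauchy-Schwarz
    majorant; [defect] is the loss. *)
Let sum_excessE : Q - scrH k.+1 h S =
  \sum_a ricci_excess (A a) + (n - 1) / n * (n - 2) * defect.
Proof.
have h2 : h ^+ 2 = \sum_a mx_mean (A a) ^+ 2.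
  by rewrite sqr_sqrtr // sumr_ge0 // => a _; exact: sqr_ge0.
have gap2 : \sum_a mx_gap (A a) ^+ 2 = n * (S - n * h ^+ 2) / (n - 1).
  rewrite (eq_bigr _ (fun a _ => mx_gap_sqr k_gt1 (A_sym a))) -mulr_suml -/n.
  by rewrite sumrB -!mulr_sumr -h2 -/S; congr (_ / _); ring.
rewrite /defect gap2 /scrH -/n.
have -> : \sum_a ricci_excess (A a) = Q - (n - 1) / n *
    (2 * n * h ^+ 2 - S - (n - 2) * \sum_a `|mx_mean (A a)| * mx_gap (A a)).
  rewrite h2 /S /Q !mulr_sumr -!sumrB mulr_sumr -sumrB.
  by apply: eq_bigr => a _; rewrite /ricci_excess -/n (mulrA (n - 2)).
move: (Num.sqrt _) (\sum_a _ * _) => s z; ring.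
Qed.

Let defect_ge0 : 0 <= defect.
Proof.
rewrite subr_ge0; have := sum_mul_le_sqrt (fun a => normr_ge0 (mx_mean (A a)))
  (fun a => sqrtr_ge0 _ : 0 <= mx_gap (A a)).
by under [X in Num.sqrt X * _]eq_bigr => a _ do rewrite real_normK ?num_real //.
Qed.

Lemma scrH_le_sum : scrH k.+1 h S <= Q.
Proof.
rewrite -subr_ge0 sum_excessE addr_ge0 //.
  by apply: sumr_ge0 => a _; exact: ricci_excess_ge0.
have := n_ge3 => n3; rewrite !mulr_ge0 ?invr_ge0 //; lra.
Qed.

Lemma scrH_eq_sum :
  Q = scrH k.+1 h S <->
  (forall a, ricci_excess (A a) = 0) /\
  (\sum_a mx_mean (A a) ^+ 2 != 0 ->
   exists2 rho, 0 <= rho & forall a, mx_gap (A a) = rho * `|mx_mean (A a)|).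
Proof.
have := sum_mul_eq_sqrt (fun a => normr_ge0 (mx_mean (A a)))
  (fun a => sqrtr_ge0 _ : 0 <= mx_gap (A a)).
under [X in Num.sqrt X * _]eq_bigr => a _ do rewrite real_normK ?num_real //.
under [X in X != 0]eq_bigr => a _ do rewrite real_normK ?num_real //.
move=> <-; rewrite -/h.
have ge0 a : 0 <= ricci_excess (A a) by exact: ricci_excess_ge0.
have sum_ge0 : 0 <= \sum_a ricci_excess (A a) by exact: sumr_ge0.
have c_gt0 : 0 < (n - 1) / n * (n - 2).
  by have := n_ge3 => n3; rewrite !mulr_gt0 ?invr_gt0 //; lra.
have d_ge0 := mulr_ge0 (ltW c_gt0) defect_ge0.
have E := sum_excessE.
split=> [QE|[e0 dE]].
  move: E; rewrite QE subrr => /esym/eqP.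
  rewrite paddr_eq0 // => /andP[/eqP s0 /eqP d0].
  split=> [a|].
    by have := psumr_eq0P (fun a _ => ge0 a) s0; move/(_ a isT).
  move/eqP: d0; rewrite mulf_eq0 (gt_eqF c_gt0) /= subr_eq0 => /eqP dE.
  exact: esym dE.
have d0 : defect = 0 by rewrite /defect -dE subrr.
by move: E; rewrite d0 mulr0 big1 // addr0 => /eqP; rewrite subr_eq0 => /eqP.
Qed.

End SumExcess.

(** * Curvature of connections in a chart *)
Section Curvature.
Context {R : realType} {m : nat}.
Local Notation vec := 'rV[R]_m.
Implicit Types (Gam : vec -> vec -> vec -> vec) (a b c q : vec).

Lemma cov_cst Gam a b : cov Gam (cst a) (cst b) = fun q => Gam q a b.
Proof. by apply/funext => q; rewrite /cov derive_cst add0r. Qed.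

Lemma lie_cst a b : lie (cst a) (cst b) = cst (0 : vec).
Proof. by apply/funext => q; rewrite /lie !derive_cst subrr. Qed.

Lemma curv_cov_cst Gam a b c q : is_bilinear2 (Gam q) ->
  curv (cov Gam) (cst a) (cst b) (cst c) q =
  'D_a (fun q => Gam q b c) q + Gam q a (Gam q b c)
  - ('D_b (fun q => Gam q a c) q + Gam q b (Gam q a c)).
Proof.
move=> Gbil; rewrite /curv lie_cst !cov_cst /cov.
by rewrite [Gam q 0 c](bilinear2_0l Gbil) subr0.
Qed.

End Curvature.

Section Ambient.
Context {R : realType} {m : nat}.
Variables (V : set 'rV[R]_m) (g : 'rV[R]_m -> 'M[R]_m).
Variable phi : 'rV[R]_m -> 'rV[R]_m.
Hypotheses (Vo : open V) (sg : smooth_on V g) (sphi : smooth_on V phi).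
Hypothesis g_sym : forall q, V q -> (g q)^T = g q.
Hypothesis g_pos : forall q x, V q -> x != 0 -> 0 < ip (g q) x x.
Implicit Types (q x y z a b c : 'rV[R]_m).

Lemma metric_unit q : V q -> g q \in unitmx.
Proof. by move=> Vq; apply: posdef_unitmx => x; exact: g_pos. Qed.

Lemma derive_metric_sym q v : V q -> ('D_v g q)^T = 'D_v g q.
Proof.
move=> Vq; have [_ gTE] := is_derive_trmx (smooth_is_derive v sg Vq).
rewrite -gTE; apply: near_eq_derive.
by apply: filterS (open_nbhs_nbhs (conj Vo Vq)) => w; exact: g_sym.
Qed.

Lemma levi_civita_bilinear q : V q -> is_bilinear2 (levi_civita g q).
Proof.
move=> Vq; have dg := smooth_differentiable sg Vq.
have DE x : 'D_x g q = 'd g q x by exact: deriveE.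
split=> [y|x] k z z'; rewrite /levi_civita scalemxAl -mulmxDl; congr (_ *m _).
  rewrite scalerA mulrC -scalerA -scalerDr; congr (_ *: _).
  apply/rowP => l; rewrite !mxE !DE linearP.
  move: ('d g q z) ('d g q z') ('d g q y) ('d g q _) => A B C D.
  by rewrite ip_mxD ip_mxZ !ipDl !ipZl; ring.
rewrite scalerA mulrC -scalerA -scalerDr; congr (_ *: _).
apply/rowP => l; rewrite !mxE !DE linearP.
move: ('d g q z) ('d g q z') ('d g q x) ('d g q _) => A B C D.
by rewrite ip_mxD ip_mxZ !ipDl !ipDr !ipZl !ipZr; ring.
Qed.

Lemma differentiable_ip (W : normedModType R) (A : W -> 'M[R]_m) u x y :
  differentiable A u -> differentiable (fun w => ip (A w) x y) u.
Proof.
move=> dA; rewrite /ip.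
have dxA : differentiable (fun w => x *m A w *m y^T) u.
  by do 2 apply: differentiable_mulmx => //; exact: differentiable_cst.
by move/differentiable_mxP : dxA; exact.
Qed.

Lemma differentiable_pairing (W : normedModType R) (A : W -> 'rV[R]_m) u x :
  differentiable A u -> differentiable (fun w => pairing (A w) x) u.
Proof.
move=> dA; rewrite /pairing.
have dxA : differentiable (fun w => A w *m x^T) u.
  by apply: differentiable_mulmx => //; exact: differentiable_cst.
by move/differentiable_mxP : dxA; exact.
Qed.

Lemma levi_civita_differentiable q x y : V q ->
  differentiable (fun q => levi_civita g q x y) q.
Proof.
move=> Vq; apply: differentiable_mulmx; last first.
  exact: differentiable_invmx (smooth_differentiable sg Vq) (metric_unit Vq).
apply: differentiableZ; apply/differentiable_mxP => i l.
under eq_fun do rewrite mxE.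
have dD v a b : differentiable (fun q => ip ('D_v g q) a b) q.
  apply: differentiable_ip.
  exact: smooth_differentiable (smooth_derive v sg) Vq.
exact: (differentiableB (differentiableD (dD _ _ _) (dD _ _ _)) (dD _ _ _)).
Qed.

Lemma agashe_chafle_bilinear q : V q -> is_bilinear2 (agashe_chafle g phi q).
Proof.
move=> Vq; have [Bl Br] := levi_civita_bilinear Vq.
split=> [y|x] k z z'; rewrite /agashe_chafle; [rewrite (Bl y)|rewrite (Br x)].
  by rewrite !scalerDr !scalerA addrACA (mulrC k).
by rewrite pairingDr pairingZr scalerDl !scalerDr scalerA addrACA.
Qed.

Lemma agashe_chafle_differentiable q x y : V q ->
  differentiable (fun q => agashe_chafle g phi q x y) q.
Proof.
move=> Vq; apply: differentiableD; first exact: levi_civita_differentiable.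
apply: differentiableZl; apply: differentiable_pairing.
exact: smooth_differentiable sphi Vq.
Qed.

(** The correction term [phi(y) x] contributes only [s], because the
    Levi-Civita part is torsion free. *)
Lemma agashe_chafle_curv q a b c : V q ->
  curv (cov (agashe_chafle g phi)) (cst a) (cst b) (cst c) q =
  curv (cov (levi_civita g)) (cst a) (cst b) (cst c) q
  + s_tensor g phi q a c *: b - s_tensor g phi q b c *: a.
Proof.
move=> Vq; have Lb := levi_civita_bilinear Vq.
rewrite !curv_cov_cst //; last exact: agashe_chafle_bilinear.
have DE x y : 'D_x (fun q => agashe_chafle g phi q y c) q =
    'D_x (fun q => levi_civita g q y c) q
    + 'D_x (fun q => pairing (phi q) c) q *: y.
  have dphi : differentiable (fun q => pairing (phi q) c) q.
    exact/differentiable_pairing/(smooth_differentiable sphi Vq).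
  have h1 := diff_is_derive x (levi_civita_differentiable y c Vq).
  have h2 := is_derive_scale (diff_is_derive x dphi) (is_derive_cst y q x).
  have [_ ->] := is_deriveD h1 h2.
  by rewrite scaler0 addr0.
have sE x y : s_tensor g phi q x y = 'D_x (fun q => pairing (phi q) y) q
    - pairing (phi q) (levi_civita g q x y)
    - pairing (phi q) x * pairing (phi q) y.
  by rewrite /s_tensor /cov_form cov_cst.
rewrite !DE !sE.
have Lsym : levi_civita g q a b = levi_civita g q b a.
  by apply: levi_civita_torsion_free => v; exact: derive_metric_sym.
rewrite /agashe_chafle !(bilinear2Dr Lb) !(bilinear2Zr Lb) Lsym.
rewrite !pairingDr !pairingZr.
move: (levi_civita g q a (levi_civita g q b c)).
move: (levi_civita g q b (levi_civita g q a c)).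
move: (levi_civita g q b c) (levi_civita g q a c) (levi_civita g q b a).
move: ('D_a (fun _ => levi_civita _ _ _ _) q).
move: ('D_b (fun _ => levi_civita _ _ _ _) q).
move: ('D_a _ q) ('D_b _ q) => r1 r2 D1 D2 L1 L2 L3 L4 L5.
move: (pairing _ L1) (pairing _ L2) (pairing _ a) (pairing _ b) (pairing _ c).
move=> p1 p2 pa pb pc.
apply/rowP => l; rewrite !mxE; ring.
Qed.

End Ambient.

(** * The Gauss equation *)
Section Gauss.
Context {R : realType} {n m : nat}.
Variables (V : set 'rV[R]_m) (g : 'rV[R]_m -> 'M[R]_m).
Variable phi : 'rV[R]_m -> 'rV[R]_m.
Hypotheses (Vo : open V) (sg : smooth_on V g) (sphi : smooth_on V phi).
Hypothesis g_sym : forall q, V q -> (g q)^T = g q.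
Hypothesis g_pos : forall q x, V q -> x != 0 -> 0 < ip (g q) x x.
Variables (U : set 'rV[R]_n) (F : 'rV[R]_n -> 'rV[R]_m).
Hypotheses (Uo : open U) (sF : smooth_on U F) (FUV : forall u, U u -> V (F u)).
Hypothesis F_inj : forall u, U u -> injective ('d F u).
Implicit Types (u x y z w : 'rV[R]_n).

Local Notation AC := (agashe_chafle g phi).
Local Notation nabla := (cov_along g phi F).
Local Notation sigma := (sff g phi F).

Lemma diff_jacobian u x : 'd F u x = x *m 'J F u.
Proof. by rewrite mul_rV_lin1. Qed.

Lemma ip_induced u x y :
  ip (induced_metric g F u) x y = ip (g (F u)) ('d F u x) ('d F u y).
Proof. by rewrite /ip !diff_jacobian trmx_mul !mulmxA. Qed.

Lemma induced_unit u : U u -> induced_metric g F u \in unitmx.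
Proof.
move=> Uu; apply: posdef_unitmx => x x0; rewrite ip_induced.
apply: g_pos; first exact: FUV.
by apply: contra_neq x0 => dx0; apply: (F_inj Uu); rewrite dx0 linear0.
Qed.

Lemma ip_tan_coord u v w : U u ->
  ip (induced_metric g F u) (tan_coord g F u v) w = ip (g (F u)) v ('d F u w).
Proof.
move=> Uu; rewrite {1}/ip /tan_coord mulmxKV; last exact: induced_unit.
by rewrite /ip diff_jacobian trmx_mul mulmxA.
Qed.

Lemma near_U u : U u -> nbhs u U.
Proof. by move=> Uu; exact: open_nbhs_nbhs. Qed.

Lemma push_derive u y : U u -> push F (cst y) u = 'D_y F u.
Proof.
by move=> Uu; rewrite deriveE //; exact: smooth_differentiable sF Uu.
Qed.

Lemma near_push u y : U u -> \forall w \near u, 'D_y F w = push F (cst y) w.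
Proof.
by move=> Uu; apply: filterS (near_U Uu) => w Uw; rewrite push_derive.
Qed.

Lemma differentiable_push u y : U u -> differentiable (push F (cst y)) u.
Proof.
move=> Uu; apply: (near_eq_differentiable (near_push y Uu)).
exact: smooth_differentiable (smooth_derive y sF) Uu.
Qed.

Lemma is_derive_push u x y : U u ->
  is_derive u x (push F (cst y)) ('D_x ('D_y F) u).
Proof.
move=> Uu; apply: (near_eq_is_derive (near_push y Uu)).
exact: smooth_is_derive (smooth_derive y sF) Uu.
Qed.

Lemma differentiable_jacobian u : U u -> differentiable (jacobian F) u.
Proof.
move=> Uu; apply/differentiable_mxP => i j.
have -> : (fun w => jacobian F w i j) =
    fun w => push F (cst (delta_mx 0 i)) w 0 j.
  by apply/funext => w; rewrite /push diff_jacobian -rowE [RHS]mxE.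
have /differentiable_mxP dpush := differentiable_push (delta_mx 0 i) Uu.
exact: (dpush 0 j).
Qed.

Lemma near_bilinear u : U u -> \forall q \near F u, is_bilinear2 (AC q).
Proof.
move=> Uu; apply: filterS (open_nbhs_nbhs (conj Vo (FUV Uu))) => q.
exact: agashe_chafle_bilinear.
Qed.

Lemma AC_differentiable u a b : U u -> differentiable (fun q => AC q a b) (F u).
Proof. by move=> Uu; apply: (agashe_chafle_differentiable sg) (FUV Uu). Qed.

Lemma nabla_push u y z : U u ->
  nabla (cst y) (push F (cst z)) u =
  ('D_y ('D_z F) u) + AC (F u) (push F (cst y) u) (push F (cst z) u).
Proof.
by move=> Uu; rewrite /cov_along /=; have [_ ->] := is_derive_push y z Uu.
Qed.

Lemma near_nabla_push u y z : U u -> \forall w \near u,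
  'D_y ('D_z F) w + AC (F w) (push F (cst y) w) (push F (cst z) w) =
  nabla (cst y) (push F (cst z)) w.
Proof.
by move=> Uu; apply: filterS (near_U Uu) => w Uw; rewrite nabla_push.
Qed.

Lemma differentiable_nabla_push u y z : U u ->
  differentiable (nabla (cst y) (push F (cst z))) u.
Proof.
move=> Uu; apply: (near_eq_differentiable (near_nabla_push y z Uu)).
apply: differentiableD.
  exact: smooth_differentiable (smooth_derive y (smooth_derive z sF)) Uu.
apply: differentiable_bilinear_comp.
- exact: near_bilinear.
- by move=> a b; exact: AC_differentiable.
- exact: smooth_differentiable sF Uu.
- exact: differentiable_push.
- exact: differentiable_push.
Qed.

(** Naturality of curvature: second derivatives of [F] cancel by symmetry of
    mixed derivatives. *)
Lemma pullback_curvature u x y z : U u ->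
  nabla (cst x) (nabla (cst y) (push F (cst z))) u
  - nabla (cst y) (nabla (cst x) (push F (cst z))) u =
  curv (cov AC) (cst ('d F u x)) (cst ('d F u y)) (cst ('d F u z)) (F u).
Proof.
move=> Uu; have ACb := nbhs_singleton (near_bilinear Uu).
rewrite curv_cov_cst //.
have DE a b : nabla (cst a) (nabla (cst b) (push F (cst z))) u =
    'D_a ('D_b ('D_z F)) u
    + ('D_('d F u a) (fun q => AC q ('d F u b) ('d F u z)) (F u)
     + AC (F u) ('D_a ('D_b F) u) ('d F u z)
     + AC (F u) ('d F u b) ('D_a ('D_z F) u))
    + (AC (F u) ('d F u a) ('D_b ('D_z F) u)
       + AC (F u) ('d F u a) (AC (F u) ('d F u b) ('d F u z))).
  have h2 := is_derive_bilinear_comp (near_bilinear Uu)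
    (fun a b => AC_differentiable a b Uu) (smooth_differentiable sF Uu)
    (is_derive_push a b Uu) (is_derive_push a z Uu).
  have h1 := smooth_is_derive a (smooth_derive b (smooth_derive z sF)) Uu.
  have [_ D] := near_eq_is_derive (near_nabla_push b z Uu) (is_deriveD h1 h2).
  by rewrite {1}/cov_along D nabla_push // (bilinear2Dr ACb).
have E1 := smooth_mixed_derivatives y x Uo (smooth_derive z sF) Uu.
have E2 := congr1 (fun h => AC (F u) h ('d F u z))
  (smooth_mixed_derivatives y x Uo sF Uu).
have cancel (d d' D D' a a' b c e e' : 'rV[R]_m) : d = d' -> a = a' ->
    d + (D + a + b) + (c + e) - (d' + (D' + a' + c) + (b + e'))
    = D + e - (D' + e').
  by move=> -> ->; apply/rowP => l; rewrite !mxE; ring.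
apply: etrans (cancel _ _ _ _ _ _ _ _ _ _ E1 E2).
exact: (congr2 (fun p q : 'rV[R]_m => p - q) (DE x y) (DE y x)).
Qed.

Lemma sff_normal u x y w : U u -> ip (g (F u)) (sigma u x y) ('d F u w) = 0.
Proof. by move=> Uu; apply: normal_part_orth; exact: induced_unit. Qed.

Lemma ip_normal_part u (N v : 'rV[R]_m) : U u ->
  (forall w, ip (g (F u)) N ('d F u w) = 0) ->
  ip (g (F u)) N (normal_part g F u v) = ip (g (F u)) N v.
Proof. by move=> Uu Nn; rewrite /normal_part ipBr Nn subr0. Qed.

(** Differentiate [g(N, dF w) = 0] along [x] and use that the Levi-Civita
    connection is metric; the last term is the failure of [nabla] to be so. *)
Lemma weingarten (N : 'rV[R]_n -> 'rV[R]_m) u x w : U u ->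
  differentiable N u ->
  (forall v z, U v -> ip (g (F v)) (N v) ('d F v z) = 0) ->
  ip (g (F u)) (nabla (cst x) N u) ('d F u w) =
  - ip (g (F u)) (N u) (sigma u x w)
  + pairing (phi (F u)) (N u) * ip (g (F u)) ('d F u x) ('d F u w).
Proof.
move=> Uu dN Nn; have Vq := FUV Uu.
have dF := smooth_differentiable sF Uu.
have dg := smooth_differentiable sg Vq.
have hN := diff_is_derive x dN.
have hg := is_derive_comp_diff x dF dg.
have hT := is_derive_push x w Uu.
have [_ D0] := is_derive_ip hg hN hT.
have : 'D_x (fun v => ip (g (F v)) (N v) (push F (cst w) v)) u = 0.
  rewrite (near_eq_derive (g := cst 0)) ?derive_cst //.
  by apply: filterS (near_U Uu) => v Uv; exact: Nn.
rewrite D0 {D0 hN hg hT}.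
rewrite (levi_civita_metric (N u) (push F (cst w) u) ('d F u x) dg
  (metric_unit g_pos Vq) (g_sym Vq)
  (fun v => derive_metric_sym Vo sg g_sym v Vq)).
have nN : ip (g (F u)) (N u) ('d F u x) = 0 by exact: Nn.
rewrite (ip_normal_part _ Uu (fun z => Nn u z Uu)) nabla_push // /agashe_chafle.
rewrite [nabla _ _ _]/cov_along /agashe_chafle /push /=.
move: ('D_x N u) ('D_x _ u) (levi_civita _ _ _ _) (levi_civita _ _ _ _) nN.
move: ('d F u x) ('d F u w) (phi (F u)) (N u) => a b f c d1 d2 l1 l2 nN.
rewrite !ipDl !ipDr !ipZl !ipZr nN.
by move=> D0; lra.
Qed.

Lemma differentiable_sff u y z : U u -> differentiable (fun w => sigma w y z) u.
Proof.
move=> Uu; have dB := differentiable_nabla_push y z Uu.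
have dJ := differentiable_jacobian Uu.
have dg : differentiable (fun w => g (F w)) u.
  apply: (differentiable_comp (smooth_differentiable sF Uu)).
  exact: smooth_differentiable sg (FUV Uu).
have dI : differentiable (induced_metric g F) u.
  apply: differentiable_mulmx (differentiable_trmx dJ).
  exact: differentiable_mulmx.
have -> : (fun w => sigma w y z) = nabla (cst y) (push F (cst z)) -
    (fun w => tan_coord g F w (nabla (cst y) (push F (cst z)) w) *m 'J F w).
  by apply/funext => w; rewrite /sff /normal_part diff_jacobian.
apply: differentiableB => //; apply: differentiable_mulmx => //.
apply: differentiable_mulmx; last exact: differentiable_invmx (induced_unit Uu).
apply: differentiable_mulmx (differentiable_trmx dJ).
exact: differentiable_mulmx.
Qed.

Lemma nablaB (A N : 'rV[R]_n -> 'rV[R]_m) u x : U u ->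
  differentiable A u -> differentiable N u ->
  nabla (cst x) (fun w => A w - N w) u = nabla (cst x) A u - nabla (cst x) N u.
Proof.
move=> Uu dA dN; have ACb := nbhs_singleton (near_bilinear Uu).
have [_ D] := is_deriveB (diff_is_derive x dA) (diff_is_derive x dN).
rewrite /cov_along D (bilinear2Dr ACb).
rewrite -(scaleN1r (N u)) (bilinear2Zr ACb) scaleN1r.
by rewrite [in RHS]opprD [RHS]addrACA.
Qed.

Lemma push_induced_conn y z w :
  push F (induced_conn g phi F (cst y) (cst z)) w =
  nabla (cst y) (push F (cst z)) w - sigma w y z.
Proof. by rewrite /sff /normal_part opprB addrC subrK. Qed.

(** The field [nabla_y z] is the ambient derivative minus [sigma(y, z)], and
    the derivative of the latter is known from [weingarten]. *)
Lemma ip_induced_conn2 u x y z w : U u ->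
  ip (induced_metric g F u)
    (induced_conn g phi F (cst x) (induced_conn g phi F (cst y) (cst z)) u) w =
  ip (g (F u)) (nabla (cst x) (nabla (cst y) (push F (cst z))) u) ('d F u w)
  + ip (g (F u)) (sigma u y z) (sigma u x w)
  - pairing (phi (F u)) (sigma u y z) * ip (g (F u)) ('d F u x) ('d F u w).
Proof.
move=> Uu.
rewrite [induced_conn _ _ _ (cst x) _ u]/induced_conn ip_tan_coord //.
have -> : push F (induced_conn g phi F (cst y) (cst z)) =
    fun w => nabla (cst y) (push F (cst z)) w - sigma w y z.
  by apply/funext => v; exact: push_induced_conn.
have dS := differentiable_sff y z Uu.
rewrite (nablaB x Uu (differentiable_nabla_push y z Uu) dS) ipBl.
rewrite (weingarten x w Uu dS (fun v a Uv => sff_normal y z a Uv)).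
by rewrite opprD opprK addrA.
Qed.

Lemma induced_conn0 u z : U u -> induced_conn g phi F (cst 0) (cst z) u = 0.
Proof.
move=> Uu; have ACb := nbhs_singleton (near_bilinear Uu).
rewrite /induced_conn /cov_along derive0 linear0 (bilinear2_0l ACb) addr0.
by rewrite /tan_coord !mul0mx.
Qed.

Theorem gauss_equation u x y z w : U u ->
  curv4 (induced_conn g phi F) (induced_metric g F) u x y z w =
  curv4 (cov (levi_civita g)) g (F u)
    ('d F u x) ('d F u y) ('d F u z) ('d F u w)
  + s_tensor g phi (F u) ('d F u x) ('d F u z)
    * ip (g (F u)) ('d F u y) ('d F u w)
  - s_tensor g phi (F u) ('d F u y) ('d F u z)
    * ip (g (F u)) ('d F u x) ('d F u w)
  + (ip (g (F u)) (sigma u y z) (sigma u x w)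
     - pairing (phi (F u)) (sigma u y z) * ip (g (F u)) ('d F u x) ('d F u w))
  - (ip (g (F u)) (sigma u x z) (sigma u y w)
     - pairing (phi (F u)) (sigma u x z) * ip (g (F u)) ('d F u y) ('d F u w)).
Proof.
move=> Uu; rewrite {1}/curv4 /curv lie_cst induced_conn0 // subr0 ipBl.
rewrite !ip_induced_conn2 //.
have := congr1 (fun v => ip (g (F u)) v ('d F u w))
  (pullback_curvature x y z Uu).
rewrite /= (agashe_chafle_curv Vo sg sphi g_sym g_pos _ _ _ (FUV Uu)).
rewrite /curv4 ipBl ipBl ipDl !ipZl.
move: (ip _ (nabla _ _ _) _) (ip _ (nabla _ _ _) _) => p q.
move: (s_tensor _ _ _ _ _) (s_tensor _ _ _ _ _) => s1 s2.
move: (ip _ (curv _ _ _ _ _) _) => r.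
move: (sff _ _ _ _ _ _) (sff _ _ _ _ _ _) (sff _ _ _ _ _ _) (sff _ _ _ _ _ _).
by move=> s3 s4 s5 s6 E; lra.
Qed.

Lemma tan_coord_push u z : U u -> tan_coord g F u ('d F u z) = z.
Proof.
move=> Uu; rewrite /tan_coord diff_jacobian.
have -> : z *m 'J F u *m g (F u) *m ('J F u)^T = z *m induced_metric g F u.
  by rewrite !mulmxA.
by rewrite mulmxK //; exact: induced_unit.
Qed.

Lemma normal_partD u (v w : 'rV[R]_m) :
  normal_part g F u (v + w) = normal_part g F u v + normal_part g F u w.
Proof.
by rewrite /normal_part /tan_coord !diff_jacobian !mulmxDl opprD addrACA.
Qed.

Lemma normal_partZ u k (v : 'rV[R]_m) :
  normal_part g F u (k *: v) = k *: normal_part g F u v.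
Proof.
by rewrite /normal_part /tan_coord !diff_jacobian -!scalemxAl scalerBr.
Qed.

Lemma normal_part_tangent u z : U u -> normal_part g F u ('d F u z) = 0.
Proof. by move=> Uu; rewrite /normal_part tan_coord_push // subrr. Qed.

(** The term [phi(y) x] is tangent, so [sigma] is the second fundamental form of
    the Levi-Civita connection; hence it is symmetric and tensorial. *)
Lemma sffE u x y : U u -> sigma u x y = normal_part g F u
  ('D_x ('D_y F) u + levi_civita g (F u) ('d F u x) ('d F u y)).
Proof.
move=> Uu; rewrite /sff nabla_push // /agashe_chafle addrA normal_partD.
by rewrite normal_partZ normal_part_tangent // scaler0 addr0.
Qed.

Lemma sff_sym u x y : U u -> sigma u x y = sigma u y x.
Proof.
move=> Uu; rewrite (sffE x y Uu) (sffE y x Uu).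
have E1 := smooth_mixed_derivatives y x Uo sF Uu.
have E2 := levi_civita_torsion_free ('d F u x) ('d F u y)
  (fun v => derive_metric_sym Vo sg g_sym v (FUV Uu)).
exact: (congr2 (fun a b => normal_part g F u (a + b)) E1 E2).
Qed.

Lemma sffDZl u k x x' y : U u ->
  sigma u (k *: x + x') y = k *: sigma u x y + sigma u x' y.
Proof.
move=> Uu; rewrite !sffE // -normal_partZ -normal_partD.
have dF2 := smooth_differentiable (smooth_derive y sF) Uu.
have dlin : 'D_(k *: x + x') ('D_y F) u =
    k *: 'D_x ('D_y F) u + 'D_x' ('D_y F) u.
  rewrite (deriveE (k *: x + x') dF2) (deriveE x dF2) (deriveE x' dF2).
  exact: linearP.
rewrite dlin (linearP ('d F u)) {dlin dF2}.
have [LCl _] := levi_civita_bilinear sg (FUV Uu).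
rewrite (LCl ('d F u y)); rewrite scalerDr; congr (normal_part g F u _).
exact: addrACA.
Qed.

Lemma pairing_dual q v : V q ->
  pairing (phi q) v = ip (g q) (dual_field g phi q) v.
Proof.
move=> Vq; rewrite /pairing /ip /dual_field mulmxKV //.
exact: (metric_unit g_pos).
Qed.

(** This is how [P^perp] enters: on normal vectors [phi] only sees the normal
    part of [P]. *)
Lemma pairing_normal u v : U u -> (forall w, ip (g (F u)) v ('d F u w) = 0) ->
  pairing (phi (F u)) v =
  ip (g (F u)) (normal_part g F u (dual_field g phi (F u))) v.
Proof.
move=> Uu vn; have gT := g_sym (FUV Uu).
rewrite (ip_sym _ v gT) ip_normal_part // ip_sym // -pairing_dual //.
exact: FUV.
Qed.

Section RicciFrame.
Variables (u : 'rV[R]_n) (e : 'I_n -> 'rV[R]_n) (i0 : 'I_n).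
Hypotheses (Uu : U u) (eP : tangent_frame g F u e) (i00 : i0 = 0%N :> nat).

Local Notation G := (g (F u)).
Local Notation Pperp := (normal_part g F u (dual_field g phi (F u))).

Let sum0 (f : 'I_n -> R) : \sum_i f i = f i0 + \sum_(j < n | (0 < j)%N) f j.
Proof.
rewrite (bigD1 i0) //=; congr (_ + _); apply: eq_bigl => j.
by rewrite lt0n -i00 (inj_eq val_inj).
Qed.

Let sum_split (c s f a b : 'I_n -> R) : a i0 = b i0 ->
  \sum_(j < n | (0 < j)%N) (c j - s j - f j + (a j - b j)) =
  \sum_(j < n | (0 < j)%N) c j - \sum_i s i + s i0 - \sum_i f i + f i0
  + (\sum_j a j - \sum_j b j).
Proof. by move=> ab; rewrite big_split /= !sumrB !sum0 ab; ring. Qed.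

(** In Gauss's equation for [R(X, e_j, e_j, X)] the terms carrying
    [g(X, e_j)] vanish. *)
Lemma ricci_frame :
  ricci g phi F u e (e i0) =
  theta g F u e (e i0) - trace_s g phi F u e
  + s_tensor g phi (F u) ('d F u (e i0)) ('d F u (e i0))
  - n%:R * ip G Pperp (mean_curv g phi F u e)
  + ip G Pperp (sigma u (e i0) (e i0))
  + (\sum_j ip G (sigma u (e i0) (e i0)) (sigma u (e j) (e j))
     - \sum_j ip G (sigma u (e i0) (e j)) (sigma u (e i0) (e j))).
Proof.
have gT := g_sym (FUV Uu).
have tE i j : ip G ('d F u (e i)) ('d F u (e j)) = (i == j)%:R.
  by rewrite -ip_induced eP.
have curvE (j : 'I_n) : (0 < j)%N ->
    curv4 (induced_conn g phi F) (induced_metric g F) u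
      (e i0) (e j) (e j) (e i0) =
    curv4 (cov (levi_civita g)) g (F u) ('d F u (e i0)) ('d F u (e j))
      ('d F u (e j)) ('d F u (e i0))
    - s_tensor g phi (F u) ('d F u (e j)) ('d F u (e j))
    - ip G Pperp (sigma u (e j) (e j))
    + (ip G (sigma u (e i0) (e i0)) (sigma u (e j) (e j))
       - ip G (sigma u (e i0) (e j)) (sigma u (e i0) (e j))).
  move=> j0; have ji0 : (j == i0) = false.
    by apply/negbTE; rewrite -(inj_eq val_inj) /= i00 -lt0n.
  have := gauss_equation (e i0) (e j) (e j) (e i0) Uu.
  rewrite !tE eqxx ji0 (sff_sym (e j) (e i0) Uu).
  rewrite (pairing_normal Uu (fun w => sff_normal (e j) (e j) w Uu)).
  rewrite (ip_sym (sigma u (e j) (e j)) (sigma u (e i0) (e i0)) gT).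
  move=> E; apply: etrans E _.
  have arith (r s s' a b c d : R) : r + s * false%:R - s' * true%:R
      + (a - b * true%:R) - (c - d * false%:R) = r - s' - b + (a - c).
    by rewrite !mulr0 !mulr1; ring.
  exact: arith.
have nH : n%:R * ip G Pperp (mean_curv g phi F u e) =
    \sum_i ip G Pperp (sigma u (e i) (e i)).
  rewrite /mean_curv ipZr ip_sumr mulrA mulfV ?mul1r //.
  by rewrite pnatr_eq0 -lt0n (leq_ltn_trans _ (ltn_ord i0)).
rewrite nH /ricci (eq_bigr _ curvE).
pose s j := s_tensor g phi (F u) ('d F u (e j)) ('d F u (e j)).
pose h j := ip G Pperp (sigma u (e j) (e j)).
pose a j := ip G (sigma u (e i0) (e i0)) (sigma u (e j) (e j)).
pose b j := ip G (sigma u (e i0) (e j)) (sigma u (e i0) (e j)).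
exact: (@sum_split _ s h a b erefl).
Qed.

End RicciFrame.

Lemma induced_sym u : U u -> (induced_metric g F u)^T = induced_metric g F u.
Proof.
move=> Uu; rewrite /induced_metric !trmx_mul trmxK mulmxA.
by rewrite (g_sym (FUV Uu)).
Qed.

Lemma parseval_sff p (nu : 'I_p -> 'rV[R]_m) u (e : 'I_n -> 'rV[R]_n) x y z w :
  m = (n + p)%N -> U u -> tangent_frame g F u e -> normal_frame g F u nu ->
  ip (g (F u)) (sigma u x y) (sigma u z w) =
  \sum_a ip (g (F u)) (sigma u x y) (nu a) * ip (g (F u)) (sigma u z w) (nu a).
Proof.
move=> mE Uu eP [nuP nuT].
apply: (@parseval_normal R n p m (g (F u)) (fun i => 'd F u (e i)) nu _ _ mE).
- exact: g_sym (FUV Uu).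
- by move=> i j; rewrite -ip_induced eP.
- exact: nuP.
- by move=> a i; exact: nuT.
- by move=> i; exact: sff_normal.
Qed.

Lemma parseval_mean_curv p (nu : 'I_p -> 'rV[R]_m) u (e : 'I_n -> 'rV[R]_n) :
  m = (n + p)%N -> U u -> tangent_frame g F u e -> normal_frame g F u nu ->
  ip (g (F u)) (mean_curv g phi F u e) (mean_curv g phi F u e) =
  \sum_a mean_comp g phi F u e (nu a) ^+ 2.
Proof.
move=> mE Uu eP [nuP nuT].
have Hn v : ip (g (F u)) (mean_curv g phi F u e) v =
    n%:R^-1 * \sum_i ip (g (F u)) (sigma u (e i) (e i)) v.
  by rewrite /mean_curv ipZl ip_suml.
have HE a : mean_comp g phi F u e (nu a) =
    ip (g (F u)) (mean_curv g phi F u e) (nu a).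
  by rewrite Hn; congr (_ * _); apply: eq_bigr => i _; rewrite mxE.
rewrite (@parseval_normal R n p m (g (F u)) (fun i => 'd F u (e i)) nu _ _ mE).
- by apply: eq_bigr => a _; rewrite HE expr2.
- exact: g_sym (FUV Uu).
- by move=> i j; rewrite -ip_induced eP.
- exact: nuP.
- by move=> a i; exact: nuT.
- by move=> i; rewrite Hn big1 ?mulr0 // => j _; exact: sff_normal.
Qed.

End Gauss.

(** * The inequality and its equality case *)

Lemma local_dom_open (R : realType) (T1 T2 : topologicalType) m1 m2
    (f : T1 -> T2) (c : chart R T1 m1) (d : chart R T2 m2) :
  continuous f -> open (local_dom f c d).
Proof.
move=> cf; rewrite openE => u [cu du].
have nc : nbhs u (chart_cod c).
  by apply: open_nbhs_nbhs; split; [exact: chart_cod_open|].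
have nd : nbhs (f (chart_inv c u)) (chart_dom d).
  by apply: open_nbhs_nbhs; split; [exact: chart_dom_open|].
have cfi : f (chart_inv c w) @[w --> u] --> f (chart_inv c u).
  exact: continuous_comp (chart_inv_continuous cu) (cf _).
exact: filterI nc (cfi _ nd).
Qed.

Lemma eig_sign_norm (R : realType) n (A : 'M[R]_n) eps :
  eig_sign A eps -> `|eps| = 1.
Proof.
move=> [s1 s0]; have [h0|hN0] := eqVneq (mx_mean A) 0.
  by case: (s0 h0) => ->; rewrite ?normrN normr1.
by rewrite s1 // normr_sg hN0.
Qed.

Lemma two_eig_gap (R : realType) k (A : 'M[R]_k.+1) eps : eig_sign A eps ->
  `|(mx_mean A - (k.+1%:R - 1) / k.+1%:R * eps * mx_gap A)
    - (mx_mean A + k.+1%:R^-1 * eps * mx_gap A)| = mx_gap A.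
Proof.
move=> /eig_sign_norm e1; have n0 : k.+1%:R != 0 :> R by rewrite pnatr_eq0.
rewrite (_ : _ - _ = - (eps * mx_gap A)); last by field.
by rewrite normrN normrM e1 mul1r ger0_norm // sqrtr_ge0.
Qed.

Theorem theorem3p1 (R : realType) (n p : nat) (n_ge3 : (3 <= n)%N)
    (M : manifold R n) (N : manifold R (n + p)) (metric : riem_metric N)
    (form : one_form N) (f : immersion M N)
    (x : M) (c : chart R M n) (d : chart R N (n + p))
    (c_atlas : atlas c) (d_atlas : atlas d)
    (x_in_c : chart_dom c x) (fx_in_d : chart_dom d (f x)) :
  let g := metric_in metric d in
  let phi := form_in form d in
  let F := local_rep f c d in
  let u := chart_map c x in
  forall X : 'rV[R]_n, ip (induced_metric g F u) X X = 1 ->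
  forall e : 'I_n -> 'rV[R]_n,
    tangent_frame g F u e -> (forall i : 'I_n, i = 0%N :> nat -> e i = X) ->
  forall nu : 'I_p -> 'rV[R]_(n + p), normal_frame g F u nu ->
  let Ric := ricci g phi F u e X in
  let sigma := sff g phi F u in
  let H := mean_curv g phi F u e in
  let normH := mean_curv_norm g phi F u e in
  let sigma_norm2 := \sum_a sff_norm2 g phi F u e (nu a) in
  let Pperp := normal_part g F u (dual_field g phi (F u)) in
  let bound :=
    theta g F u e X - trace_s g phi F u e
    + s_tensor g phi (F u) ('d F u X) ('d F u X)
    - n%:R * ip (g (F u)) Pperp H
    + ip (g (F u)) Pperp (sigma X X)
    + scrH n normH sigma_norm2 in
  Ric >= bound /\
  (Ric = bound <->
   exists2 e' : 'I_n -> 'rV[R]_n,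
     tangent_frame g F u e' /\ (forall i : 'I_n, i = 0%N :> nat -> e' i = X) &
   exists2 eps : 'I_p -> R,
     (forall a, (mean_comp g phi F u e' (nu a) != 0 ->
                   eps a = Num.sg (mean_comp g phi F u e' (nu a))) /\
                (mean_comp g phi F u e' (nu a) = 0 ->
                   eps a = 1 \/ eps a = -1)) &
     let lam a := eig_lambda g phi F u e' (eps a) (nu a) in
     let mu a := eig_mu g phi F u e' (eps a) (nu a) in
     (forall a, sff_mx g phi F u e' (nu a) =
        \matrix_(i, j) (if i == j then if i == 0%N :> nat then lam a else mu a
                        else 0)) /\
     (H != 0 -> exists2 rho : R, 0 <= rho &
        forall a, `|lam a - mu a| = rho * `|mean_comp g phi F u e' (nu a)|)).
Proof.
case: n n_ge3 M N metric form f x c d c_atlas d_atlas x_in_c fx_in_d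
  => [//|k] k_gt1 M N metric form f x c d c_atlas d_atlas x_in_c fx_in_d.
move=> g phi F u X _ e eP eX nu nuP.
have Vo : open (chart_cod d) by exact: chart_cod_open.
have sg : smooth_on (chart_cod d) g by exact: metric_smooth.
have sphi : smooth_on (chart_cod d) phi by exact: form_smooth.
have g_sym q : chart_cod d q -> (g q)^T = g q.
  by move=> Vq; exact: Defs.metric_sym.
have g_pos q y : chart_cod d q -> y != 0 -> 0 < ip (g q) y y.
  by move=> Vq; exact: metric_pos.
have Uo : open (local_dom f c d).
  by apply: local_dom_open; exact: imm_continuous.
have sF : smooth_on (local_dom f c d) F by exact: imm_smooth.
have FUV w : local_dom f c d w -> chart_cod d (F w).
  by move=> [_ ?]; exact: chart_map_cod.
have F_inj w : local_dom f c d w -> injective ('d F w).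
  exact: imm_inj.
have Uu : local_dom f c d u.
  by split; [exact: chart_map_cod|rewrite /u chart_mapK].
(* Only the properties established above are used from here on. *)
clearbody g phi F u.
have Is := induced_sym g_sym FUV Uu.
pose b a y z := ip (g (F u)) (sff g phi F u y z) (nu a).
have b_sym a y z : b a y z = b a z y.
  exact: (congr1 (fun v => ip (g (F u)) v (nu a))
    (sff_sym phi Vo sg g_sym g_pos Uo sF FUV F_inj y z Uu)).
have bDl a l y z w : b a (l *: y + z) w = l * b a y w + b a z w.
  by rewrite /b (sffDZl phi sg g_pos Uo sF FUV F_inj l y z w Uu) ipDl ipZl.
pose A t a : 'M[R]_k.+1 := form_mx (b a) t.
have A_sym t a : (A t a)^T = A t a.
  by apply/matrixP => i j; rewrite !mxE b_sym.
have e0 : e ord0 = X by exact: eX.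
have pars y z v w :=
  parseval_sff phi g_sym g_pos FUV F_inj y z v w erefl Uu eP nuP.
pose S := \sum_a mx_norm2 (A e a).
pose h := Num.sqrt (\sum_a mx_mean (A e a) ^+ 2).
pose Q := \sum_a (A e a ord0 ord0 * (\sum_i A e a i i)
                  - \sum_j A e a ord0 j ^+ 2).
have Q1 : \sum_j ip (g (F u)) (sff g phi F u X X) (sff g phi F u (e j) (e j)) =
    \sum_a A e a ord0 ord0 * (\sum_i A e a i i).
  rewrite (eq_bigr _ (fun j _ => pars X X (e j) (e j))) exchange_big /=.
  apply: eq_bigr => a _; rewrite mulr_sumr; apply: eq_bigr => i _.
  by rewrite !mxE e0.
have Q2 : \sum_j ip (g (F u)) (sff g phi F u X (e j)) (sff g phi F u X (e j)) =
    \sum_a \sum_j A e a ord0 j ^+ 2.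
  rewrite (eq_bigr _ (fun j _ => pars X (e j) X (e j))) exchange_big /=.
  by apply: eq_bigr => a _; apply: eq_bigr => j _; rewrite mxE e0 expr2.
have HE : ip (g (F u)) (mean_curv g phi F u e) (mean_curv g phi F u e) =
    \sum_a mx_mean (A e a) ^+ 2.
  exact: (parseval_mean_curv phi g_sym g_pos FUV F_inj erefl Uu eP nuP).
have H0 : mean_curv g phi F u e != 0 <-> \sum_a mx_mean (A e a) ^+ 2 != 0.
  rewrite -HE; split=> [HN0|]; last by apply: contra_neq => ->; rewrite ip0l.
  by rewrite gt_eqF //; apply: g_pos => //; exact: FUV.
have hE : mean_curv_norm g phi F u e = h by rewrite /mean_curv_norm HE.
have RicE := ricci_frame Vo sg sphi g_sym g_pos Uo sF FUV F_inj
  (i0 := ord0) Uu eP erefl.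
rewrite e0 Q1 Q2 -sumrB -/Q in RicE.
move=> Ric sigma H normH sigma_norm2 Pperp bound.
have RicQ : Ric - bound = Q - scrH k.+1 h S.
  by rewrite /Ric RicE /bound /normH hE opprD addrACA subrr add0r.
have equality : Ric = bound <-> Q = scrH k.+1 h S.
  split=> /eqP E; apply/eqP; first by rewrite -subr_eq0 -RicQ subr_eq0.
  by rewrite -subr_eq0 RicQ subr_eq0.
split; first by rewrite -subr_ge0 RicQ subr_ge0; exact: scrH_le_sum.
apply: iff_trans equality _; apply: iff_trans (scrH_eq_sum k_gt1 (A_sym e)) _.
split=> [[excess0 gapE]|[e' [e'P e'X] [eps eps_sign [AE gapE]]]].
  have /choice[eps epsP] : forall a, exists eps,
      eig_sign (A e a) eps /\ A e a = two_eig_mx (A e a) eps.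
    move=> a.
    have [eps] := (ricci_excess_eq0 k_gt1 (A_sym e a)).1 (excess0 a).
    by exists eps.
  exists e; first by split.
  exists eps => [a|]; first exact: (epsP a).1.
  split=> [a|/H0 /gapE [rho rho0 rhoE]]; first exact: (epsP a).2.
  exists rho; first exact: rho0.
  by move=> a; rewrite -rhoE -(two_eig_gap (epsP a).1).
have e'0 : e' ord0 = e ord0 by rewrite e0; exact: e'X.
split=> [a|/H0 /gapE [rho rho0 rhoE]].
  rewrite -(ricci_excess_frame Is eP e'P (b_sym a) (bDl a) e'0).
  apply/(ricci_excess_eq0 k_gt1 (A_sym e' a)).
  by exists (eps a); [exact: eps_sign|exact: AE].
exists rho; first exact: rho0.
move=> a; rewrite -(gap_frame Is eP e'P (b_sym a) (bDl a)).
rewrite -(mean_frame Is eP e'P (b_sym a) (bDl a)).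
by rewrite -(two_eig_gap (eps_sign a)); exact: rhoE.
Qed.
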